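(* Let $\Omega\subset\mathbb{R}^d$ be a bounded domain with piecewise smooth boundary and let $0<T<\infty$. Let $\varphi:L^2(\Omega)\to\,]-\infty,+\infty]$ be defined by $\varphi(u)=\int_\Omega|Du|$ if $u\in BV(\Omega)\cap L^2(\Omega)$ and $\varphi(u)=+\infty$ otherwise, and let $\partial\varphi$ be its subdifferential in $L^2(\Omega)$. Then for each $u_0\in L^2(\Omega)=\overline{D(\partial\varphi)}$ there is a unique function $u\in C([0,T];L^2(\Omega))$, with $u\in W^{1,\infty}([\delta,T];L^2(\Omega))$ for all $\delta\in(0,T)$, such that $$\frac{d^+}{dt}u(t)+(\partial\varphi(u(t)))^0=0\quad\text{for all }t\in(0,T),\qquad u(0)=u_0.$$ If $u_0\in D(\partial\varphi)$, then $u\in W^{1,\infty}([0,T];L^2(\Omega))$.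
   Context: For $u\in L^1(\Omega)$, the total variation is $$\|Du\|=\int_\Omega|Du|=\sup\Big\{\int_\Omega u\operatorname{div}\psi\,dx:\ \psi\in C_0^\infty(\Omega;\mathbb{R}^d),\ |\psi|_\infty\le1\Big\},$$ and $BV(\Omega)$ is the set of $u\in L^1(\Omega)$ with $\|Du\|<+\infty$. The subdifferential is $$\partial\varphi(u)=\{\eta\in L^2(\Omega):\ \varphi(u)\le\varphi(v)+\langle\eta,u-v\rangle\ \text{ for all }v\in BV(\Omega)\cap L^2(\Omega)\},$$ for $u\in BV(\Omega)\cap L^2(\Omega)$ (empty otherwise), where $\langle\cdot,\cdot\rangle$ is the inner product of $L^2(\Omega)$; $D(\partial\varphi)=\{u:\partial\varphi(u)\ne\emptyset\}$. $(\partial\varphi(u))^0$ denotes the minimal section of $\partial\varphi(u)$, i.e. its element of minimal $L^2(\Omega)$-norm. $\frac{d^+}{dt}$ is the right derivative in $L^2(\Omega)$. For a Banach space $X$, $W^{1,\infty}([a,b];X)$ is the space of absolutely continuous functions $u:[a,b]\to X$ that are a.e. differentiable with $\frac{du}{dt}\in L^\infty(a,b;X)$. *)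

(* Defs.v *)
From HB Require Import structures.
From mathcomp Require Import all_boot all_order all_algebra.
From mathcomp Require Import all_classical all_reals all_analysis.
From mathcomp Require Import measurable_realfun.

Set Implicit Arguments.
Unset Strict Implicit.
Unset Printing Implicit Defensive.

Import Order.TTheory GRing.Theory Num.Theory.
Import numFieldNormedType.Exports.

Local Open Scope classical_set_scope.
Local Open Scope ring_scope.

Notation borel_rV R n := (g_sigma_algebraType (@open 'rV[R]_n)).

(* Lebesgue measure on the Borel sets of R^n: lebesgue_rV n.+1 is the image of
   lebesgue_rV n \x lebesgue_measure under (x, t) |-> (t, x_0, .., x_(n-1)). *)
Section lebesgue_rV.
Variable R : realType.

Lemma open_rV_measurable n (U : set 'rV[R]_n) : open U ->
  measurable (U : set (borel_rV R n)).
Proof. exact: sub_sigma_algebra. Qed.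

Lemma ball_rVE n (x y : 'rV[R]_n) (e : R) :
  0 < e -> ball x e y <-> forall j, `|x 0 j - y 0 j| < e.
Proof.
move=> e0; split => [[_ +] j|h]; first by move=> /(_ 0 j).
by split => // i j; rewrite !ord1; exact: h.
Qed.

Lemma open_rV_bigcup n (U : set 'rV[R]_n) : open U ->
  U = \bigcup_(q in [set q : 'rV[rat]_n * rat | 0 < q.2 /\
         ball (map_mx ratr q.1 : 'rV[R]_n) (ratr q.2) `<=` U])
      ball (map_mx ratr q.1 : 'rV[R]_n) (ratr q.2).
Proof.
move=> oU; apply/seteqP; split; last by move=> x [q [_ sU]] /sU.
move=> x Ux; have /nbhs_ballP[e /= e0 eU] := open_nbhs_nbhs (conj oU Ux).
have e20 : 0 < e / 2 by rewrite divr_gt0.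
have [r] := rat_in_itvoo e20; rewrite in_itv/= => /andP[r0R re].
have r0 : 0 < r by rewrite ltr0q in r0R.
have hq (j : 'I_n) : exists q : rat, ratr q \in `]x 0 j - ratr r, x 0 j + ratr r[.
  have : x 0 j - ratr r < x 0 j + ratr r by rewrite ltrD2l gt0_cp.
  by move=> /rat_in_itvoo[q]; exists q.
pose q := \row_j projT1 (cid (hq j)).
have xq : ball (map_mx ratr q : 'rV[R]_n) (ratr r) x.
  apply/ball_rVE => // j; rewrite !mxE; case: cid => s /=.
  by rewrite in_itv/= -ltr_distl.
exists (q, r) => //=; split => // y /(ball_rVE _ _ r0R) yq; apply: eU.
apply/ball_rVE => // j; have /ball_rVE := xq => /(_ r0R j) xqj.
have yqj := yq j.
rewrite -(subrK (map_mx ratr q 0 j) (x 0 j)) -addrA.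
by rewrite (le_lt_trans (ler_normD _ _))// [ltRHS]splitr ltrD// ?(distrC (x 0 j)) (lt_trans _ re).
Qed.

Definition rV_cons n (p : borel_rV R n * measurableTypeR R) : borel_rV R n.+1 :=
  \row_i oapp (fun j => p.1 0 j) p.2 (unlift ord0 i).

Lemma measurable_rV_cons n : measurable_fun [set: _] (@rV_cons n).
Proof.
apply: (@measurability _ _ _ (borel_rV R n.+1) setT (@rV_cons n) (@open 'rV[R]_n.+1)) => //.
move=> _ [U oU <-]; rewrite setTI (open_rV_bigcup oU) preimage_bigcup.
rewrite bigcup_mkcond; apply: countable_bigcupT_measurable; first exact: countableP.
move=> q; case: ifPn => [/set_mem[q0 _]|_]; last exact: measurable0.
have q0R : 0 < ratr q.2 :> R by rewrite ltr0q.
set c := map_mx ratr q.1 : 'rV[R]_n.+1.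
rewrite (_ : _ @^-1` _ = ball (\row_j c 0 (lift ord0 j)) (ratr q.2) `*`
  ball (c 0 ord0 : R) (ratr q.2)).
  apply: measurableX; first by apply: open_rV_measurable; exact: ball_open.
  exact: measurable_realfun.measurable_ball.
apply/seteqP; split => [p /ball_rVE h | p [/ball_rVE h1 h2]].
  split.
    apply/ball_rVE => // j; have := h q0R (lift ord0 j).
    by rewrite !mxE liftK.
  by have := h q0R ord0; rewrite !mxE unlift_none.
apply/ball_rVE => // i; rewrite !mxE; case: unliftP => [j ->|->] /=.
  by have := h1 q0R j; rewrite !mxE.
by have : `|c 0 ord0 - p.2| < ratr q.2 := h2; rewrite mxE.
Qed.

Section lebesgue_cons.
Variables (n : nat) (m : {measure set (borel_rV R n) -> \bar R}).

Definition lebesgue_cons : set (borel_rV R n.+1) -> \bar R :=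
  pushforward (m \x lebesgue_measure)%E (@rV_cons n).

Let lebesgue_cons0 : lebesgue_cons set0 = 0%E.
Proof. by rewrite /lebesgue_cons /pushforward preimage_set0 measure0. Qed.

Let lebesgue_cons_ge0 A : (0 <= lebesgue_cons A)%E.
Proof. exact: (measure_ge0 (m \x lebesgue_measure)%E). Qed.

Let lebesgue_cons_sigma_additive : semi_sigma_additive lebesgue_cons.
Proof.
have mf A : measurable A -> measurable (@rV_cons n @^-1` A).
  by move=> mA; rewrite -[X in measurable X]setTI; exact: measurable_rV_cons.
move=> F mF tF mUF; rewrite /lebesgue_cons /pushforward preimage_bigcup.
apply: measure_semi_sigma_additive.
- by move=> k; exact: mf.
- apply/trivIsetP => /= i j _ _ ij; rewrite -preimage_setI.
  by move/trivIsetP : tF => /(_ _ _ _ _ ij) ->//; rewrite preimage_set0.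
- by rewrite -preimage_bigcup; exact: mf.
Qed.

HB.instance Definition _ := isMeasure.Build _ _ _ lebesgue_cons
  lebesgue_cons0 lebesgue_cons_ge0 lebesgue_cons_sigma_additive.
End lebesgue_cons.

Fixpoint lebesgue_rV n : {measure set (borel_rV R n) -> \bar R} :=
  if n is n'.+1 then [the measure _ _ of lebesgue_cons (lebesgue_rV n')]
  else [the measure _ _ of \d_ (0 : borel_rV R 0)].
Lemma lebesgue_rV_box n (a b : 'rV[R]_n) :
  lebesgue_rV n [set x : 'rV[R]_n | forall i, a 0 i < x 0 i < b 0 i] =
  (\prod_(i < n) lebesgue_measure `]a 0%R i, b 0%R i[%classic)%E.
Proof.
elim: n a b => [|n IHn] a b.
  rewrite big_ord0 /= diracE mem_set//= => i.
  by case: i.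
rewrite big_ord_recl /= /lebesgue_cons /pushforward.
pose a' := \row_(i < n) a 0 (lift ord0 i).
pose b' := \row_(i < n) b 0 (lift ord0 i).
rewrite (_ : _ @^-1` _ = [set x : 'rV[R]_n | forall i, a' 0 i < x 0 i < b' 0 i]
  `*` `]a 0 ord0, b 0 ord0[%classic); last first.
  apply/seteqP; split => [p h|p [h1 h2] i].
    split => [i|]; first by have := h (lift ord0 i); rewrite !mxE liftK.
    by have := h ord0; rewrite /= !mxE unlift_none/= in_itv.
  rewrite !mxE; case: unliftP => [j ->|->] /=; last by rewrite /= in_itv/= in h2.
  by have := h1 j; rewrite !mxE.
rewrite product_measure1E//; last first.
  apply: open_rV_measurable.
  rewrite (_ : mkset _ = [set x : 'rV[R]_n | forall i,
      ((fun y : 'rV[R]_n => y 0 i) @^-1` `]a' 0 i, b' 0 i[) x]); last first.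
    by apply/seteqP; split => x h i; have := h i; rewrite /= in_itv.
  rewrite openE => x hx; rewrite /interior; apply/(filter_forall (F := nbhs x)) => i.
  apply: open_nbhs_nbhs; split; last exact: hx.
  apply: (@open_comp _ _ (fun y : 'rV[R]_n => y 0 i)) => [y _|].
    exact: coord_continuous.
  exact: interval_open.
rewrite IHn muleC; congr (_ * _)%E.
by apply: eq_bigr => i _; rewrite !mxE.
Qed.

End lebesgue_rV.

(* L^2(mu) as the normed space of square-integrable functions modulo equality
   mu-almost everywhere. *)
Section L2.
Local Open Scope quotient_scope.
Context d (T : measurableType d) (R : realType).
Variable mu : {measure set T -> \bar R}.

Notation Lfun2 := (LfunType mu (lee1n 2)).

Definition ae_null : {pred Lfun2} :=
  mem [set f : Lfun2 | \forall x \ae mu, f x = 0].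

Lemma ae_null_zmod_closed : zmod_closed ae_null.
Proof.
split; first by rewrite inE/=; exact: aeW.
move=> f g; rewrite !inE/= => f0 g0.
apply: filterS2 f0 g0 => x f0 g0.
by rewrite -[LHS]/(f x - g x) f0 g0 subrr.
Qed.
HB.instance Definition _ := GRing.isZmodClosed.Build Lfun2 ae_null
  ae_null_zmod_closed.

Definition L2 : Type := Quotient.quot ae_null.
HB.instance Definition _ := Choice.on L2.
HB.instance Definition _ := GRing.Zmodule.on L2.
HB.instance Definition _ := EqQuotient.on L2.

Definition L2class (f : Lfun2) : L2 := \pi_(Quotient.quot ae_null) f.

Definition L2fun (u : L2) : Lfun2 := repr (u : Quotient.quot ae_null).

Lemma L2funK u : L2class (L2fun u) = u.
Proof. exact: reprK. Qed.

Lemma L2_eqP (f g : Lfun2) :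
  L2class f = L2class g <-> \forall x \ae mu, f x = g x.
Proof.
split.
  move=> /eqP; rewrite /L2class piE Quotient.equivE inE/=; apply: filterS => x.
  by rewrite -[LHS]/(f x - g x) => /subr0_eq.
move=> fg; apply/eqP; rewrite /L2class piE Quotient.equivE inE/=.
by apply: filterS fg => x fg; rewrite -[LHS]/(f x - g x) fg subrr.
Qed.

Lemma L2classK (f : Lfun2) : \forall x \ae mu, L2fun (L2class f) x = f x.
Proof. by apply/L2_eqP; rewrite L2funK. Qed.

Lemma L2classD (f g : Lfun2) : L2class (f + g) = L2class f + L2class g.
Proof. by rewrite /L2class piE. Qed.

Definition L2_scale (a : R) (u : L2) : L2 := L2class (a *: L2fun u).

Lemma L2_scale_class a (f : Lfun2) : L2_scale a (L2class f) = L2class (a *: f).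
Proof.
apply/L2_eqP; apply: filterS (L2classK f) => x fx.
by rewrite -[LHS]/(a * L2fun (L2class f) x) fx.
Qed.

Let scaleA a b u : L2_scale a (L2_scale b u) = L2_scale (a * b) u.
Proof. by rewrite [L2_scale b u]/L2_scale L2_scale_class scalerA. Qed.
Let scale1 : left_id 1 L2_scale.
Proof. by move=> u; rewrite /L2_scale scale1r L2funK. Qed.
Let scaleDr : right_distributive L2_scale +%R.
Proof.
move=> a u v; rewrite -(L2funK u) -(L2funK v) -L2classD.
by rewrite !L2_scale_class scalerDr L2classD.
Qed.
Let scaleDl u : {morph L2_scale^~ u : a b / a + b}.
Proof. by move=> a b /=; rewrite /L2_scale scalerDl L2classD. Qed.
HB.instance Definition _ :=
  GRing.Zmodule_isLmodule.Build R L2 scaleA scale1 scaleDr scaleDl.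

Definition L2_norm (u : L2) : R := fine 'N[mu]_2[EFin \o L2fun u].

Lemma eq_L2_norm (f g : Lfun2) : (\forall x \ae mu, f x = g x) ->
  'N[mu]_2[EFin \o f]%E = 'N[mu]_2[EFin \o g]%E.
Proof.
have mpow (h : Lfun2) :
    measurable_fun setT (fun x => (`|(EFin \o h) x| `^ 2)%E).
  apply: (@measurableT_comp _ _ _ _ _ _ (fun y : \bar R => poweR y 2)).
    exact: measurable_poweR.
  apply: measurableT_comp => //; apply/measurable_realfun.measurable_EFinP.
  exact: measurable_funPT.
move=> fg; rewrite unlock; congr poweR; apply: ae_eq_integral => //.
by apply: filterS fg => x /= -> _.
Qed.

Lemma L2_norm_class (f : Lfun2) :
  L2_norm (L2class f) = fine 'N[mu]_2[EFin \o f].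
Proof. by congr fine; apply: eq_L2_norm; exact: L2classK. Qed.

Let normD u v : L2_norm (u + v) <= L2_norm u + L2_norm v.
Proof.
by rewrite -(L2funK u) -(L2funK v) -L2classD !L2_norm_class; exact: ler_LnormD.
Qed.
Let normZ a u : L2_norm (a *: u) = `|a| * L2_norm u.
Proof.
rewrite -[a *: u]/(L2class (a *: L2fun u)) L2_norm_class /L2_norm.
by apply: EFin_inj; rewrite EFinM !finite_norm_fine (LnormZ (L2fun u) a).
Qed.
Let norm_eq0 u : L2_norm u = 0 -> u = 0.
Proof.
move=> /fine_Lnormr_eq0 u0; have -> : 0 = L2class 0 by rewrite /L2class piE.
by rewrite -(L2funK u); apply/L2_eqP; apply: filterS u0 => x /(_ I).
Qed.
HB.instance Definition _ := @Lmodule_isNormed.Build R L2 L2_norm normD normZ norm_eq0.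

Lemma L2_normE u : `|u| = fine 'N[mu]_2[EFin \o L2fun u].
Proof. by []. Qed.

Definition L2_inner (u v : L2) : R := (\int[mu]_x (L2fun u x * L2fun v x))%R.

End L2.

Section smoothness.
Context (R : realType) (V W : normedModType R).

(* For V of finite dimension, this is the class C^k. *)
Fixpoint Ck (k : nat) (f : V -> W) : Prop :=
  continuous f /\
  if k is k'.+1 then
    forall v, (forall x, derivable f x v) /\ Ck k' (fun x => 'D_v f x)
  else True.

Definition smooth (f : V -> W) : Prop := forall k, Ck k f.

End smoothness.

Section domains.
Context (R : realType) (d : nat).
Implicit Types Omega : set 'rV[R]_d.

Definition boundary Omega := closure Omega `\` interior Omega.

(* The boundary is a finite union of parametrized patches, each the image of
   the closed unit cube of R^(d-1) under a C^1 map which is injective and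
   immersive on the open cube; the images of the open cubes do not overlap.
   C^1 is the weakest usual meaning of smooth here. *)
Definition piecewise_smooth_boundary Omega : Prop :=
  let ccube := [set x : 'rV[R]_d.-1 | forall j, 0 <= x 0 j <= 1] in
  let ocube := [set x : 'rV[R]_d.-1 | forall j, 0 < x 0 j < 1] in
  exists (N : nat) (g : 'I_N -> 'rV[R]_d.-1 -> 'rV[R]_d),
    [/\ forall k, Ck 1 (g k),
        forall k, {in ocube &, injective (g k)},
        forall k x v, ocube x -> 'D_v (g k) x = 0 -> v = 0,
        forall k l, k != l -> g k @` ocube `&` g l @` ocube = set0 &
        boundary Omega = \bigcup_k (g k @` ccube)].

End domains.

Section total_variation.
Context (R : realType) (d : nat) (Omega : set 'rV[R]_d) (oO : open Omega).

Definition lebesgue_on : {measure set (borel_rV R d) -> \bar R} :=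
  [the measure _ _ of mrestr (lebesgue_rV R d) (open_rV_measurable oO)].

Definition divergence (psi : 'rV[R]_d -> 'rV[R]_d) (x : 'rV[R]_d) : R :=
  \sum_(i < d) ('D_(delta_mx 0 i) psi x) 0 i.

Definition euclidean_norm (v : 'rV[R]_d) : R :=
  Num.sqrt (\sum_(i < d) v 0 i ^+ 2).

(* C_0^oo(Omega; R^d), its elements being extended by 0 outside Omega *)
Definition test_field (psi : 'rV[R]_d -> 'rV[R]_d) : Prop :=
  let supp := closure [set x | psi x != 0] in
  [/\ smooth psi, compact supp & supp `<=` Omega].

Definition total_variation (f : 'rV[R]_d -> R) : \bar R :=
  ereal_sup [set (\int[lebesgue_on]_x (f x * divergence psi x)%:E)%E |
    psi in [set psi | test_field psi /\ forall x, euclidean_norm (psi x) <= 1]].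

Definition BV (f : 'rV[R]_d -> R) : Prop :=
  f \in Lfun lebesgue_on 1%E /\ (total_variation f < +oo)%E.

Notation L2O := (L2 lebesgue_on).

Definition phi (u : L2O) : \bar R :=
  if `[< BV (L2fun u) >] then total_variation (L2fun u) else +oo%E.

Definition subdiff_phi (u : L2O) : set L2O :=
  [set eta | BV (L2fun u) /\
    forall v : L2O, BV (L2fun v) ->
      (phi u <= phi v + (L2_inner eta (u - v))%:E)%E].

Definition dom_subdiff_phi : set L2O := [set u | subdiff_phi u !=set0].

End total_variation.
Arguments total_variation {R d Omega} oO f.
Arguments BV {R d Omega} oO f.
Arguments phi {R d Omega} oO u.
Arguments subdiff_phi {R d Omega} oO u.
Arguments dom_subdiff_phi {R d Omega} oO.

Section vector_valued.
Context (R : realType) (X : normedModType R).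
Implicit Types (u : R -> X) (a b t : R).

Definition minimal_section (A : set X) : set X :=
  [set x | A x /\ forall y, A y -> `|x| <= `|y|].

Definition right_derivative u t (l : X) : Prop :=
  h^-1 *: (u (t + h) - u t) @[h --> 0^'+] --> l.

Definition absolutely_continuous a b u : Prop :=
  forall e, 0 < e -> exists2 r : R, 0 < r &
    forall (n : nat) (s t : 'I_n -> R),
      (forall i, [/\ a <= s i, s i <= t i & t i <= b]) ->
      (forall i j, i != j -> t i <= s j \/ t j <= s i) ->
      \sum_(i < n) (t i - s i) < r ->
      \sum_(i < n) `|u (t i) - u (s i)| < e.

Definition simple_function (s : R -> X) : Prop :=
  finite_set (range s) /\ forall y, measurable (s @^-1` [set y]).

Definition strongly_measurable (D : set R) u : Prop :=
  exists s : nat -> R -> X, (forall n, simple_function (s n)) /\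
    \forall t \ae lebesgue_measure, D t -> s n t @[n --> \oo] --> u t.

Definition Linfty (D : set R) u : Prop :=
  strongly_measurable D u /\
  exists M : R, \forall t \ae lebesgue_measure, D t -> `|u t| <= M.

Definition W1infty a b u : Prop :=
  [/\ absolutely_continuous a b u,
      \forall t \ae lebesgue_measure, `]a, b[%classic t -> derivable u t 1 &
      Linfty `]a, b[ (derive1 u)].

End vector_valued.

Section flow.
Context (R : realType) (d : nat) (Omega : set 'rV[R]_d) (oO : open Omega).
Notation L2O := (L2 (lebesgue_on oO)).

Definition TV_flow (T : R) (u0 : L2O) (u : R -> L2O) : Prop :=
  [/\ {within `[0, T], continuous u},
      forall r, 0 < r < T -> W1infty r T u,
      forall t, 0 < t < T -> exists du eta : L2O,
        [/\ right_derivative u t du,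
            minimal_section (subdiff_phi oO (u t)) eta &
            du + eta = 0] &
      u 0 = u0].

End flow.

(* Main.v *)
Require Import Defs.
From HB Require Import structures.
From mathcomp Require Import all_boot all_order all_algebra.
From mathcomp Require Import all_classical all_reals all_analysis.
From mathcomp Require Import ring lra measurable_realfun.
Set Implicit Arguments.
Unset Strict Implicit.
Unset Printing Implicit Defensive.
Import Order.TTheory GRing.Theory Num.Theory.
Import numFieldNormedType.Exports.
Local Open Scope classical_set_scope.
Local Open Scope ring_scope.

(** The functional phi is a supremum of linear forms u |-> <div psi, u>, so it is
    the support function of the closed convex set dual_ball of L^2. Its
    subdifferential at u is the set of elements of dual_ball that are maximal in
    the direction u (subdiff_phiE). Such an operator A is monotone; it has full
    range in the sense of Minty, because its resolvent is computed by projecting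
    onto dual_ball (maximizers_full_range); and it is invariant under positive
    rescaling of u. Everything else is the theory of contraction semigroups for
    such operators in a Hilbert space H, here L^2, which is complete by the
    Riesz-Fischer argument (L2_fast_cauchy_cvg).

    Existence. The implicit Euler schemes x |-> (I + h A)^(-k) x form a Cauchy
    family when k * h tends to t, by Kobayashi's inequality (euler_dist), and
    their limit is a contraction semigroup S t, the flow. On the domain it is
    Lipschitz in t and its speed never increases. Its right derivative is
    identified without weak compactness. Elements of A near x and difference
    quotients of the flow both satisfy an angle condition with respect to the
    Yosida approximations of A at x (yosida_angle, flow_angle); the latter
    converge in norm to the minimal section (yosida_bounded_domain), so a vector
    with the angle condition and almost minimal norm is close to the minimal
    section (min_section_near).

    Smoothing. Since A (c *: x) contains A x for c > 0, the flow satisfies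
    S (c * t) (c *: x) = c *: S t x. Comparing S (t + a * t) x with S t x for
    small a then bounds the speed at time t by 2 * |x| / t (flow_time_scaling,
    flow_smoothing). Hence every trajectory enters the domain at once, and from
    any positive time on it is Lipschitz. The speed is monotone, hence
    continuous up to countably many times, and where it is continuous the flow
    has a two-sided derivative (flow_derivative); this gives membership in
    W^(1,oo), from time 0 on if the initial datum lies in the domain.

    Uniqueness. The distance between two solutions does not increase, because
    its square has a nonpositive right derivative (solution_unique).

    Density of the domain. The resolvents of a function of finite total
    variation lie in the domain and converge to it (maximizers_dense), so it is
    enough that functions of finite total variation are dense in L^2. A bounded
    Lipschitz function has finite total variation: in its integral against
    div psi, the derivatives of psi are limits of difference quotients, and the
    translation invariance of Lebesgue measure moves these to the function
    (lipschitz_total_variation). The bounded Lipschitz functions are dense,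
    because only 0 is orthogonal to all of them (lipschitz_orthogonal). *)

(** * Inner products and projections *)

Record inner_product (R : realType) (H : normedModType R) (ip : H -> H -> R) :
    Prop := InnerProduct {
  ipC : forall x y, ip x y = ip y x ;
  ipDl : forall x y z, ip (x + y) z = ip x z + ip y z ;
  ipZl : forall a x y, ip (a *: x) y = a * ip x y ;
  ipxx : forall x, ip x x = `|x| ^+ 2 }.

Section inner_product_theory.
Context (R : realType) (H : normedModType R) (ip : H -> H -> R).
Hypothesis hip : inner_product ip.
Implicit Types (x y z : H) (a b : R).

Lemma ipDr x y z : ip x (y + z) = ip x y + ip x z.
Proof. by rewrite (ipC hip) (ipDl hip) !(ipC hip x). Qed.

Lemma ipZr a x y : ip x (a *: y) = a * ip x y.
Proof. by rewrite (ipC hip) (ipZl hip) (ipC hip x). Qed.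

Lemma ipNl x y : ip (- x) y = - ip x y.
Proof. by rewrite -scaleN1r (ipZl hip) mulN1r. Qed.

Lemma ipNr x y : ip x (- y) = - ip x y.
Proof. by rewrite (ipC hip) ipNl (ipC hip x). Qed.

Lemma ip0l x : ip 0 x = 0.
Proof. by rewrite -(scale0r 0) (ipZl hip) mul0r. Qed.

Lemma ip0r x : ip x 0 = 0.
Proof. by rewrite (ipC hip) ip0l. Qed.

Lemma ipBl x y z : ip (x - y) z = ip x z - ip y z.
Proof. by rewrite (ipDl hip) ipNl. Qed.

Lemma ipBr x y z : ip x (y - z) = ip x y - ip x z.
Proof. by rewrite ipDr ipNr. Qed.

(** Moving every vector identity under the inner product turns it into a ring
    identity between scalars. *)
Definition ipE := (ipDl hip, ipDr, ipNl, ipNr, ipZl hip, ipZr, ip0l, ip0r).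

Lemma eq_ip x y : (forall z, ip x z = ip y z) -> x = y.
Proof.
move=> h; apply/subr0_eq/eqP; rewrite -normr_eq0 -sqrf_eq0 -(ipxx hip).
by rewrite ipBl h subrr.
Qed.

Lemma sqr_normD x y : `|x + y| ^+ 2 = `|x| ^+ 2 + 2 * ip x y + `|y| ^+ 2.
Proof. by rewrite -!(ipxx hip) (ipDl hip) !ipDr (ipC hip y x); ring. Qed.

Lemma sqr_normB x y : `|x - y| ^+ 2 = `|x| ^+ 2 - 2 * ip x y + `|y| ^+ 2.
Proof. by rewrite sqr_normD ipNr normrN; ring. Qed.

Lemma cauchy_schwarz x y : ip x y <= `|x| * `|y|.
Proof.
have [->|x0] := eqVneq x 0; first by rewrite ip0l normr0 mul0r.
have [->|y0] := eqVneq y 0; first by rewrite ip0r normr0 mulr0.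
have nx : 0 < `|x| by rewrite normr_gt0.
have ny : 0 < `|y| by rewrite normr_gt0.
have := sqr_ge0 (`| `|y| *: x - `|x| *: y|).
rewrite sqr_normB (ipZl hip) ipZr !normrZ !normr_id => h.
have {}h : 0 <= (`|x| * `|y|) * (2 * (`|x| * `|y| - ip x y)) by lra.
by rewrite pmulr_rge0 ?mulr_gt0// in h; lra.
Qed.

Lemma ler_sqr_norm x y : `|x| ^+ 2 <= `|y| ^+ 2 -> `|x| <= `|y|.
Proof. by rewrite ler_sqr ?nnegrE. Qed.

Lemma cvg_ip (T : Type) (F : set_system T) (FF : Filter F) (u v : T -> H) x y :
  u @ F --> x -> v @ F --> y -> ip (u n) (v n) @[n --> F] --> ip x y.
Proof.
move=> ux vy.
have E z z' : ip z z' = (`|z + z'| ^+ 2 - `|z| ^+ 2 - `|z'| ^+ 2) / 2.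
  by rewrite sqr_normD; field.
rewrite (_ : (fun n => _) = fun n =>
  (`|u n + v n| ^+ 2 - `|u n| ^+ 2 - `|v n| ^+ 2) / 2); last first.
  by apply/funext => n; exact: E.
rewrite E; apply: cvgM; last exact: cvg_cst.
have sq (w : T -> H) z : w @ F --> z -> `|w n| ^+ 2 @[n --> F] --> `|z| ^+ 2.
  by move=> wz; apply: cvgM; exact: cvg_norm.
by apply: cvgB; [apply: cvgB|]; apply: sq => //; exact: cvgD.
Qed.

End inner_product_theory.

(** Both uses concern quadratic estimates, for which it is convenient to bound
    the squares of the distances. *)
Lemma cauchy_modulus_cvg (R : realType) (H : completeNormedModType R)
    (u : nat -> H) (f : nat -> R) :
  f @ \oo --> 0 -> (forall n m, (n <= m)%N -> `|u m - u n| ^+ 2 <= f n) ->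
  cvgn u.
Proof.
move=> f0 uf; apply/cauchy_cvgP/cauchy_exP => e e0.
have e20 : 0 < e ^+ 2 by rewrite exprn_gt0.
have := (@cvgr_lt _ _ _ _ f 0 f0 _ e20) => -[N _ hN].
exists (u N); exists N => // n /= Nn; rewrite -ball_normE/= distrC.
rewrite -(@ltr_pXn2r _ 2)// ?nnegrE// ?(ltW e0)//.
exact: (le_lt_trans (uf _ _ Nn) (hN _ (leqnn _))).
Qed.

Section projection.
Context (R : realType) (H : completeNormedModType R) (ip : H -> H -> R).
Hypothesis hip : inner_product ip.

Definition convex_subset (C : set H) := forall x y (s : R), 0 <= s <= 1 ->
  C x -> C y -> C (x + s *: (y - x)).

(** By the parallelogram law a minimizing sequence is Cauchy; the inequality
    is the first-order condition at the minimum along the segments of C. *)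
Lemma projection_exists (C : set H) : C !=set0 -> closed C -> convex_subset C ->
  forall x, exists p, C p /\ forall g, C g -> ip (x - p) (g - p) <= 0.
Proof.
move=> [c0 Cc0] clC cvC x.
pose E := [set `|x - g| ^+ 2 | g in C].
have hE : has_inf E.
  split; first by exists (`|x - c0| ^+ 2), c0.
  by exists 0 => _ [g _ <-]; rewrite exprn_ge0.
pose d := inf E.
have dle g : C g -> d <= `|x - g| ^+ 2.
  by move=> Cg; apply: ge_inf; [exact: hE.2 | exists g].
have exg n : exists g, C g /\ `|x - g| ^+ 2 < d + n.+1%:R^-1.
  have n0 : 0 < n.+1%:R^-1 :> R by rewrite invr_gt0.
  by have [_ [g Cg <-] gd] := inf_adherent n0 hE; exists g.
pose g n := projT1 (cid (exg n)).
have Cg n : C (g n) by rewrite /g; case: cid => ? [].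
have gd n : `|x - g n| ^+ 2 < d + n.+1%:R^-1 by rewrite /g; case: cid => ? [].
have gcvg : cvgn g.
  apply: (@cauchy_modulus_cvg _ _ _ (fun n => 4 * harmonic n)).
    by rewrite -(mulr0 4); apply: cvgM; [exact: cvg_cst|exact: cvg_harmonic].
  move=> n m nm.
  have h2 : 0 <= (2^-1 : R) <= 1 by lra.
  have := dle _ (cvC _ _ 2^-1 h2 (Cg n) (Cg m)).
  have hn := gd n; have hm := gd m.
  have hmn : m.+1%:R^-1 <= n.+1%:R^-1 :> R by rewrite lef_pV2 ?posrE// ler_nat.
  have -> : x - (g n + 2^-1 *: (g m - g n)) = 2^-1 *: ((x - g m) + (x - g n)).
    by apply: (eq_ip hip) => z; rewrite !(ipE hip); field.
  rewrite normrZ exprMn (sqr_normD hip) => h.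
  have -> : g m - g n = (x - g n) - (x - g m).
    by apply: (eq_ip hip) => z; rewrite !(ipE hip); ring.
  rewrite (sqr_normB hip) (ipC hip (x - g n)) /harmonic /=.
  have h4 : `|2^-1 : R| ^+ 2 = 4^-1 by rewrite ger0_norm ?invr_ge0//; field.
  move: h hn hm hmn; rewrite h4 /harmonic /=.
  by move: n.+1%:R^-1 m.+1%:R^-1 => r r'; lra.
pose p := limn g.
have gp : g @ \oo --> p by exact: gcvg.
have Cp : C p by exact: (closed_cvg C clC (nearW _ Cg) p gp).
have dp : `|x - p| ^+ 2 <= d.
  have n1 : (fun n => d + harmonic n) @ \oo --> d.
    by rewrite -[X in _ --> X]addr0; apply: cvgD; [exact: cvg_cst|exact: cvg_harmonic].
  have n2 : `|x - g n| ^+ 2 @[n --> \oo] --> `|x - p| ^+ 2.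
    have h : `|x - g n| @[n --> \oo] --> `|x - p|.
      by apply: cvg_norm; apply: cvgB => //; exact: cvg_cst.
    exact: (cvgM h h).
  by apply: (ler_cvg_to n2 n1); apply: nearW => n; exact: ltW (gd n).
exists p; split => // g' Cg'; rewrite leNgt; apply/negP => i0.
set i := ip _ _ in i0.
have key s : 0 <= s <= 1 -> 0 <= s * (s * `|g' - p| ^+ 2 - 2 * i).
  move=> s01; have := le_trans dp (dle _ (cvC _ _ s s01 Cp Cg')).
  have -> : x - (p + s *: (g' - p)) = (x - p) - s *: (g' - p).
    by rewrite opprD addrA.
  by rewrite (sqr_normB hip (x - p)) (ipZr hip) -/i normrZ exprMn real_normK ?num_real//; lra.
set q := `|g' - p| ^+ 2 in key.
have q0 : 0 <= q by rewrite exprn_ge0.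
(* short enough for the linear gain 2 * s * i to beat the cost s ^ 2 * q *)
pose s := i / (q + i).
have qi : 0 < q + i by lra.
have s0 : 0 < s by rewrite divr_gt0.
have s1 : s <= 1 by rewrite ler_pdivrMr//; lra.
have k : 0 <= s <= 1 by rewrite (ltW s0) s1.
have := key s k; rewrite (pmulr_rge0 _ s0) => k1.
have k2 : s * (q + i) = i by rewrite /s; field; rewrite gt_eqF.
have k3 : 0 <= s * i by apply/ltW/mulr_gt0.
lra.
Qed.

End projection.

(** * Maximal monotone operators *)

Lemma cvg_invS {R : realType} : (n.+1%:R^-1 : R) @[n --> \oo] --> (0 : R).
Proof. exact: cvg_harmonic. Qed.

Lemma invS_gt0 {R : realType} n : 0 < n.+1%:R^-1 :> R.
Proof. by rewrite invr_gt0. Qed.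

Section maximal_monotone.
Context (R : realType) (H : completeNormedModType R) (ip : H -> H -> R).
Hypothesis hip : inner_product ip.
Context (A : H -> set H).

Definition monotone_graph := forall x y xi eta, A x xi -> A y eta ->
  0 <= ip (xi - eta) (x - y).

Definition full_range := forall h x, 0 < h -> exists y, A y (h^-1 *: (x - y)).

Definition resolvent h x := xget x [set y | A y (h^-1 *: (x - y))].

Definition yosida h x := h^-1 *: (x - resolvent h x).

Hypothesis mA : monotone_graph.
Hypothesis rA : full_range.

Notation J := resolvent.
Notation Y := yosida.
Implicit Types (h : R) (x y z xi eta zeta : H).

Lemma yosida_in h x : 0 < h -> A (J h x) (Y h x).
Proof.
move=> h0; rewrite /yosida /resolvent.
by case: xgetP => [y -> //|]; have [y Ay] := rA x h0; move/(_ y).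
Qed.

Lemma resolventE h x : 0 < h -> x = J h x + h *: Y h x.
Proof.
move=> h0; rewrite /yosida scalerA mulfV ?gt_eqF// scale1r.
by rewrite addrC subrK.
Qed.

Lemma resolvent_eq h x : 0 < h -> J h x = x - h *: Y h x.
Proof. by move=> h0; rewrite [X in X - _](resolventE x h0) addrK. Qed.

Lemma resolvent_unique h x y : 0 < h -> A y (h^-1 *: (x - y)) -> y = J h x.
Proof.
move=> h0 Ay; have := mA Ay (yosida_in x h0).
have -> : h^-1 *: (x - y) - Y h x = - (h^-1 *: (y - J h x)).
  by apply: (eq_ip hip) => z; rewrite /yosida !(ipE hip); ring.
rewrite (ipNl hip) (ipZl hip) (ipxx hip) => yJ.
have h1 : 0 < h^-1 by rewrite invr_gt0.
have {}yJ : h^-1 * `|y - J h x| ^+ 2 <= 0 by lra.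
rewrite pmulr_rle0// in yJ.
apply/subr0_eq/eqP; rewrite -normr_eq0 -sqrf_eq0 eq_le yJ/=.
by rewrite exprn_ge0.
Qed.

(** Kobayashi's inequality: it compares steps of different lengths, and
    is what makes the Euler schemes of all step sizes a Cauchy family. *)
Lemma resolvent_kobayashi l m x y : 0 < l -> 0 < m ->
  (l + m) * `|J l x - J m y| ^+ 2 <=
  l * `|J l x - y| ^+ 2 + m * `|x - J m y| ^+ 2.
Proof.
move=> l0 m0; have := mA (yosida_in x l0) (yosida_in y m0).
have := resolventE x l0; have := resolventE y m0.
move: (J l x) (J m y) (Y l x) (Y m y) => a b xi zeta Ey Ex.
rewrite [X in l * `|a - X| ^+ 2]Ey [X in m * `|X - b| ^+ 2]Ex.
have -> : a - (b + m *: zeta) = (a - b) - m *: zeta by rewrite opprD addrA.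
have -> : a + l *: xi - b = (a - b) + l *: xi by rewrite addrAC.
move: (a - b) => c; rewrite (sqr_normB hip) (sqr_normD hip) !normrZ !exprMn.
rewrite !real_normK ?num_real// !(ipZr hip) (ipBl hip) !(ipC hip c) => mono.
have : 0 <= l * m ^+ 2 * `|zeta| ^+ 2 + m * l ^+ 2 * `|xi| ^+ 2.
  by rewrite addr_ge0// !mulr_ge0 ?exprn_ge0 ?(ltW l0) ?(ltW m0).
have : 0 <= l * m * (ip xi c - ip zeta c) by rewrite !mulr_ge0 ?(ltW l0) ?(ltW m0).
lra.
Qed.

Lemma resolvent_contraction h x y : 0 < h -> `|J h x - J h y| <= `|x - y|.
Proof.
move=> h0; apply: ler_sqr_norm; have := mA (yosida_in x h0) (yosida_in y h0).
have := resolventE x h0; have := resolventE y h0.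
move: (J h x) (J h y) (Y h x) (Y h y) => a b xi zeta Ey Ex.
rewrite [X in _ <= `|X - _| ^+ 2]Ex [X in _ <= `|_ - X| ^+ 2]Ey.
have -> : a + h *: xi - (b + h *: zeta) = (a - b) + h *: (xi - zeta).
  by apply: (eq_ip hip) => z; rewrite !(ipE hip); ring.
rewrite (sqr_normD hip (a - b)) (ipZr hip) (ipC hip (a - b)) => mono.
have : 0 <= h * ip (xi - zeta) (a - b) by rewrite mulr_ge0 ?(ltW h0).
have : 0 <= `|h *: (xi - zeta)| ^+ 2 by rewrite exprn_ge0.
lra.
Qed.

(** This is monotonicity between (y, eta) and (J h x, Y h x), where
    y - J h x = (y - x) + h * Y h x: an element eta of A y cannot turn away from
    Y h x when y is close to x. *)
Lemma yosida_angle h x y eta e : 0 < h -> A y eta -> `|y - x| <= e ->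
  `|Y h x| ^+ 2 - (`|eta| + `|Y h x|) * e / h <= ip eta (Y h x).
Proof.
move=> h0 Ay yx; have := mA Ay (yosida_in x h0).
have -> : y - J h x = (y - x) + h *: Y h x.
  by rewrite {2}(resolventE x h0) opprD addrA subrK.
set v := Y h x; rewrite (ipDr hip) (ipZr hip) [ip (eta - v) v](ipBl hip) (ipxx hip).
have := cauchy_schwarz hip (eta - v) (y - x).
have : `|eta - v| * `|y - x| <= (`|eta| + `|v|) * e.
  by apply: ler_pM => //; exact: ler_normB.
set B := (_ + _) * e; move=> h1 h2 h3.
by rewrite lerBlDr -lerBlDl ler_pdivlMr//; lra.
Qed.

Lemma yosida_le h x eta : 0 < h -> A x eta -> `|Y h x| <= `|eta|.
Proof.
move=> h0 Ax; have := @yosida_angle h x x eta 0 h0 Ax.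
rewrite subrr normr0 lexx mulr0 mul0r subr0 => /(_ isT) le1.
have := le_trans le1 (cauchy_schwarz hip _ _); rewrite expr2.
have [->|Y0] := eqVneq (Y h x) 0; first by rewrite normr0.
by rewrite ler_pM2r// normr_gt0.
Qed.

Lemma yosida_lipschitz h x y : 0 < h -> `|Y h x - Y h y| <= 2 * h^-1 * `|x - y|.
Proof.
move=> h0; rewrite /yosida -scalerBr normrZ gtr0_norm ?invr_gt0//.
rewrite (mulrC 2) -mulrA ler_pM2l ?invr_gt0//.
have -> : x - J h x - (y - J h y) = (x - y) - (J h x - J h y).
  by apply: (eq_ip hip) => z; rewrite !(ipE hip); ring.
by rewrite (le_trans (ler_normB _ _))// mulr2n mulrDl mul1r lerD2l resolvent_contraction.
Qed.

(** Minty's argument: the resolvent of x + xi is a point of the graph at which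
    the assumed inequality leaves no choice but (x, xi). *)
Lemma graph_maximal x xi :
  (forall y eta, A y eta -> 0 <= ip (eta - xi) (y - x)) -> A x xi.
Proof.
move=> mx; have := mx _ _ (yosida_in (x + xi) ltr01).
have := yosida_in (x + xi) ltr01.
rewrite /yosida invr1 scale1r; set y := J _ _.
have -> : x + xi - y - xi = - (y - x).
  by apply: (eq_ip hip) => z; rewrite !(ipE hip); ring.
move=> Ay; rewrite (ipNl hip) (ipxx hip) oppr_ge0 => yx.
have xy : y = x.
  apply/subr0_eq/eqP; rewrite -normr_eq0 -sqrf_eq0 eq_le yx/=.
  by rewrite exprn_ge0.
by move: Ay; rewrite xy addrAC subrr add0r.
Qed.

Lemma graph_closed (u v : nat -> H) x xi : (forall n, A (u n) (v n)) ->
  u @ \oo --> x -> v @ \oo --> xi -> A x xi.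
Proof.
move=> Auv ux vxi; apply: graph_maximal => y eta Ay.
have l : ip (eta - v n) (y - u n) @[n --> \oo] --> ip (eta - xi) (y - x).
  by apply: (cvg_ip hip); apply: cvgB => //; exact: cvg_cst.
by apply: (cvgr_to_ge l); apply: nearW => n; exact: mA.
Qed.

(** The distance between two Yosida approximations is paid for by the growth
    of their norm as the parameter decreases; a bounded family is thus Cauchy. *)
Lemma yosida_monotone l m x : 0 < m -> m <= l ->
  `|Y l x - Y m x| ^+ 2 <= `|Y m x| ^+ 2 - `|Y l x| ^+ 2.
Proof.
move=> m0; rewrite le_eqVlt => /predU1P[->|ml].
  by rewrite subrr normr0 expr0n subrr.
have l0 := lt_trans m0 ml.
have := mA (yosida_in x l0) (yosida_in x m0).
have -> : J l x - J m x = m *: Y m x - l *: Y l x.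
  rewrite (resolvent_eq x l0) (resolvent_eq x m0).
  move: (Y l x) (Y m x) => a b.
  by apply: (eq_ip hip) => z; rewrite !(ipE hip); ring.
move: (Y l x) (Y m x) => v w.
rewrite (sqr_normB hip) !(ipE hip) !(ipxx hip) (ipC hip w).
set a := `|v| ^+ 2; set b := `|w| ^+ 2; set c := ip _ _ => mono.
have d0 : 0 <= a - 2 * c + b.
  by rewrite /a /c /b -(sqr_normB hip) exprn_ge0.
have lm : (l + m) * (a - 2 * c + b) <= (l - m) * (b - a) by lra.
have ba : 0 <= b - a.
  rewrite -(@pmulr_rge0 _ (l - m)) ?subr_gt0//; apply: le_trans lm.
  by rewrite mulr_ge0// addr_ge0 ?ltW.
rewrite -(@ler_pM2l _ (l + m)) ?addr_gt0//; apply: (le_trans lm).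
by rewrite ler_wpM2r//; lra.
Qed.

(** A bound on the Yosida approximations at x forces x into the domain, and
    their limit is then the element of least norm. No weak compactness is
    involved, because monotonicity makes the approximations Cauchy. *)
Lemma yosida_bounded_domain x M : (forall h, 0 < h -> `|Y h x| <= M) ->
  exists eta, minimal_section (A x) eta /\ `|eta| <= M.
Proof.
move=> YM; pose v n := Y n.+1%:R^-1 x.
pose s := `|v n| ^+ 2 @[n --> \oo].
have M0 : 0 <= M by apply: le_trans (YM 1 ltr01).
have ndv : nondecreasing_seq (fun n => `|v n| ^+ 2).
  move=> n m nm; rewrite -subr_ge0; apply: le_trans (exprn_ge0 2 (normr_ge0 _)) _.
  by apply: yosida_monotone; [exact: invS_gt0|rewrite lef_pV2 ?posrE// ler_nat].
have cs : cvgn (fun n => `|v n| ^+ 2).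
  apply: nondecreasing_is_cvgn => //; exists (M ^+ 2) => _ [n _ <-].
  by rewrite ler_pXn2r ?nnegrE//; exact: YM (invS_gt0 n).
pose a := limn (fun n => `|v n| ^+ 2).
have va n : `|v n| ^+ 2 <= a := nondecreasing_cvgn_le ndv cs n.
have cv : cvgn v.
  apply: (@cauchy_modulus_cvg _ _ _ (fun n => a - `|v n| ^+ 2)).
    by rewrite -(subrr a); apply: cvgB; [exact: cvg_cst|exact: cs].
  move=> n m nm; rewrite distrC; apply: le_trans (yosida_monotone _ _ _) _.
  - exact: invS_gt0.
  - by rewrite lef_pV2 ?posrE// ler_nat.
  - by rewrite lerD2r; exact: va.
have cJ : J n.+1%:R^-1 x @[n --> \oo] --> x.
  rewrite -[X in _ --> X]subr0.
  rewrite (_ : (fun n => _) = (fun n => x - n.+1%:R^-1 *: v n)); last first.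
    apply/funext => n; rewrite {2}(resolventE x (invS_gt0 n)).
    by rewrite addrK.
  apply: cvgB; first exact: cvg_cst.
  rewrite -(scale0r (limn v)); apply: cvgZ; first exact: cvg_invS.
  exact: cv.
have Al : A x (limn v).
  by apply: graph_closed cJ cv => n; exact: yosida_in (invS_gt0 n).
have le B : (forall n, `|v n| <= B) -> `|limn v| <= B.
  by move=> vB; apply: (cvgr_to_le (cvg_norm cv)); exact: nearW.
exists (limn v); split; last by apply: le => n; exact: YM (invS_gt0 n).
split => // zeta Az; apply: le => n; exact: yosida_le (invS_gt0 n) Az.
Qed.

Definition min_section x := xget 0 (minimal_section (A x)).
Notation A0 := min_section.

Lemma min_sectionP x eta : A x eta -> minimal_section (A x) (A0 x).
Proof.
move=> Ax; rewrite /min_section; case: xgetP => [y -> //|].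
have [|xi [m _] /(_ xi)//] := @yosida_bounded_domain x `|eta|.
by move=> h h0; exact: yosida_le.
Qed.

(** The bound passes to the limit through the Yosida approximations, which are
    Lipschitz, where one would otherwise extract a weak limit of v. *)
Lemma domain_limit (u v : nat -> H) x M : u @ \oo --> x ->
  (forall n, A (u n) (v n) /\ `|v n| <= M) -> exists eta, A x eta /\ `|eta| <= M.
Proof.
move=> ux Auv; have [|xi [[Ax _] xiM]] := @yosida_bounded_domain x M; last by exists xi.
move=> h h0.
have l : M + 2 * h^-1 * `|u n - x| @[n --> \oo] --> M.
  rewrite -[X in _ --> X]addr0; apply: cvgD; first exact: cvg_cst.
  rewrite -[X in _ --> X](mulr0 (2 * h^-1)); apply: cvgM; first exact: cvg_cst.
  rewrite -(@normr0 _ H) -(subrr x); apply: cvg_norm; apply: cvgB => //.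
  exact: cvg_cst.
apply: (cvgr_to_ge l); apply: nearW => n; have [Aun vM] := Auv n.
rewrite -[Y h x](subrK (Y h (u n))) (le_trans (ler_normD _ _))// addrC lerD//.
  exact: le_trans (yosida_le h0 Aun) vM.
by rewrite distrC (distrC (u n)) distrC yosida_lipschitz.
Qed.

Lemma yosida_norm_approx x eta e : A x eta -> 0 < e ->
  exists h, 0 < h /\ `|A0 x| ^+ 2 - e < `|Y h x| ^+ 2.
Proof.
move=> Ax e0; apply: contrapT => /forallNP nex.
have YM h : 0 < h -> `|Y h x| ^+ 2 <= `|A0 x| ^+ 2 - e.
  by move=> h0; rewrite leNgt; apply/negP => lt; apply: (nex h).
have M0 : 0 <= `|A0 x| ^+ 2 - e by exact: le_trans (exprn_ge0 _ _) (YM 1 ltr01).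
have [|xi [[Axi _] xiM]] := @yosida_bounded_domain x (Num.sqrt (`|A0 x| ^+ 2 - e)).
  move=> h h0; rewrite -(@ler_pXn2r _ 2) ?nnegrE ?sqrtr_ge0// sqr_sqrtr//.
  exact: YM.
have [_ /(_ _ Axi) le] := min_sectionP Ax.
have := le_trans le xiM; rewrite -(@ler_pXn2r _ 2) ?nnegrE ?sqrtr_ge0// sqr_sqrtr//.
lra.
Qed.

(** A vector that is barely longer than the minimal section and makes, with
    every Yosida approximation, the angle found in yosida_angle is close to
    the minimal section. This replaces the usual weak-limit argument, both for
    difference quotients of the flow and for nearby points of the graph. *)
Lemma min_section_near x xi e : A x xi -> 0 < e ->
  exists d, 0 < d /\ forall q M r, `|q| <= M -> M <= `|A0 x| + d ->
    0 <= r <= d ->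
    (forall h, 0 < h ->
       `|Y h x| ^+ 2 - (M + `|Y h x|) * r / h <= ip q (Y h x)) ->
    `|q - A0 x| <= e.
Proof.
move=> Ax e0; have [AA0 _] := min_sectionP Ax.
have e20 : 0 < e ^+ 2 / 16 by rewrite divr_gt0 ?exprn_gt0.
have [h [h0 Yh]] := yosida_norm_approx Ax e20.
have Ym := yosida_le h0 AA0.
set m := `|A0 x| in Yh Ym *; have m0 : 0 <= m by exact: normr_ge0.
pose K := (2 * m + 1) * (1 + 2 / h).
have h1 : 0 < h^-1 by rewrite invr_gt0.
have K0 : 0 < K by rewrite mulr_gt0//; lra.
(* K collects the effect of the excess d of the norm and of the error d / h in
   the angle *)
exists (Num.min 1 (e ^+ 2 / 16 / K)); set d := Num.min _ _.
have d1 : d <= 1 by rewrite /d ge_min lexx.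
have d0 : 0 < d by rewrite /d lt_min ltr01 divr_gt0.
have dK : d * K <= e ^+ 2 / 16 by rewrite -ler_pdivlMr// /d ge_min lexx orbT.
split => // q M r qM Mm /andP[r0 rd] /(_ h h0); set v := Y h x in Yh Ym * => qv.
have A0v : m ^+ 2 >= `|A0 x - v| ^+ 2 + `|v| ^+ 2.
  have := @yosida_angle h x x _ 0 h0 AA0; rewrite subrr normr0 lexx mulr0 mul0r.
  by rewrite subr0 => /(_ isT); rewrite -/v (sqr_normB hip) -/m; lra.
have n1 : `|A0 x - v| <= e / 4.
  rewrite -(@ler_pXn2r _ 2) ?nnegrE//; last by lra.
  by rewrite expr_div_n -[4 ^+ 2]natrX; lra.
have M0 : 0 <= M by exact: le_trans qM.
have q2 : `|q| ^+ 2 <= (m + d) ^+ 2.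
  by rewrite ler_pXn2r ?nnegrE//; [exact: le_trans Mm|rewrite addr_ge0// ltW].
have b1 : (M + `|v|) * r / h <= (2 * m + 1) * d / h.
  rewrite ler_pM2r//; apply: ler_pM => //; first by rewrite addr_ge0.
  by lra.
have b2 : (m + d) ^+ 2 - m ^+ 2 <= (2 * m + 1) * d.
  have : d * d <= d by rewrite -[leRHS]mulr1 ler_wpM2l// ltW.
  by rewrite sqrrD; lra.
have dKE : d * K = (2 * m + 1) * d + 2 * ((2 * m + 1) * d / h) by rewrite /K; ring.
have n2 : `|q - v| <= e / 2.
  rewrite -(@ler_pXn2r _ 2) ?nnegrE//; last by lra.
  by rewrite (sqr_normB hip) expr_div_n; lra.
rewrite -(subrK v q) -addrA (le_trans (ler_normD _ _))// (distrC v); lra.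
Qed.

End maximal_monotone.

(** * The implicit Euler scheme and its semigroup *)

Section euler.
Context (R : realType) (H : completeNormedModType R) (ip : H -> H -> R).
Hypothesis hip : inner_product ip.
Context (A : H -> set H).
Hypothesis mA : monotone_graph ip A.
Hypothesis rA : full_range A.
Notation J := (resolvent A).
Notation Y := (yosida A).
Notation A0 := (min_section A).
Implicit Types (h s t : R) (x y z xi eta zeta : H).

Definition euler h k x := iter k (J h) x.

Lemma euler_contraction h k x y : 0 < h ->
  `|euler h k x - euler h k y| <= `|x - y|.
Proof.
move=> h0; elim: k => //= k IH.
exact: le_trans (resolvent_contraction hip mA rA _ _ h0) IH.
Qed.

Lemma euler_domain h k x eta : 0 < h -> A x eta ->
  exists zeta, A (euler h k x) zeta /\ `|zeta| <= `|eta|.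
Proof.
move=> h0 Ax; elim: k => [|k [zeta [Az ze]]]; first by exists eta.
exists (Y h (euler h k x)); split; first exact: yosida_in.
exact: le_trans (yosida_le hip mA rA h0 Az) ze.
Qed.

Lemma euler_dist0 h k x eta : 0 < h -> A x eta ->
  `|euler h k x - x| <= `|eta| * (k%:R * h).
Proof.
move=> h0 Ax; elim: k => [|k IH]; first by rewrite subrr normr0 mul0r mulr0.
have [zeta [Az ze]] := euler_domain k h0 Ax.
have -> : euler h k.+1 x - x = (euler h k x - x) - h *: Y h (euler h k x).
  by rewrite [euler h k.+1 x](resolvent_eq A _ h0) addrAC.
rewrite (le_trans (ler_normB _ _))// -natr1 mulrDl mul1r mulrDr lerD//.
rewrite normrZ gtr0_norm// mulrC ler_wpM2r ?(ltW h0)//.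
exact: le_trans (yosida_le hip mA rA h0 Az) ze.
Qed.

(** The right-hand side satisfies Kobayashi's inequality with equality, as a
    function of the pair (i, j), and dominates on the two axes. *)
Lemma euler_dist l m i j x eta : 0 < l -> 0 < m -> A x eta ->
  `|euler l i x - euler m j x| ^+ 2 <=
  `|eta| ^+ 2 * ((i%:R * l - j%:R * m) ^+ 2 + i%:R * l ^+ 2 + j%:R * m ^+ 2).
Proof.
move=> l0 m0 Ax; have e0 : 0 <= `|eta| ^+ 2 by rewrite exprn_ge0.
have base k h : 0 < h -> `|euler h k x - x| ^+ 2 <=
    `|eta| ^+ 2 * ((k%:R * h) ^+ 2 + k%:R * h ^+ 2).
  move=> h0; apply: (@le_trans _ _ (`|eta| ^+ 2 * (k%:R * h) ^+ 2)).
    rewrite -exprMn ler_pXn2r ?nnegrE// ?mulr_ge0 ?(ltW h0)//.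
    exact: euler_dist0.
  by rewrite ler_wpM2l// lerDl mulr_ge0// exprn_ge0// ltW.
elim: i j => [|i IHi] j.
  rewrite distrC (le_trans (base j m m0))// !mul0r sub0r addr0.
  by rewrite ler_wpM2l// sqrrN.
elim: j => [|j IHj].
  by rewrite (le_trans (base i.+1 l l0))// !mul0r subr0 addr0.
have := resolvent_kobayashi hip mA rA (euler l i x) (euler m j x) l0 m0.
rewrite -[J l _]/(euler l i.+1 x) -[J m _]/(euler m j.+1 x) => K.
rewrite -(@ler_pM2l _ (l + m)) ?addr_gt0//; apply: (le_trans K).
have K1 := ler_wpM2l (ltW l0) IHj.
have K2 := ler_wpM2l (ltW m0) (IHi j.+1).
apply: le_trans (lerD K1 K2) _.
move: (`|eta| ^+ 2) => E; rewrite -!natr1.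
move: (i%:R) (j%:R) => a b.
rewrite le_eqVlt; apply/orP; left; apply/eqP; ring.
Qed.

(** The number of steps of length 1 / (n + 1) that fit in [0, t]. *)
Definition steps t n := Num.truncn (t * n.+1%:R).
Notation mesh := (fun n : nat => n.+1%:R^-1 : R).

Lemma steps_bounds t n : 0 <= t ->
  t - n.+1%:R^-1 < (steps t n)%:R * n.+1%:R^-1 <= t.
Proof.
move=> t0; have n0 : 0 < n.+1%:R :> R by [].
have tn : 0 <= t * n.+1%:R by rewrite mulr_ge0.
have /andP[k1 k2] := truncn_itv tn.
rewrite -/(steps t n) in k1 k2.
rewrite ler_pdivrMr// k1 andbT ltrBlDr -[X in _ + X]mul1r -mulrDl ltr_pdivlMr//.
by rewrite natr1.
Qed.

Lemma cvg_steps t : 0 <= t -> (steps t n)%:R * mesh n @[n --> \oo] --> t.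
Proof.
move=> t0; apply: (@squeeze_cvgr nat \oo _ R (fun n => t - mesh n) (fun=> t)).
- by apply: nearW => n; have /andP[/ltW -> ->] := steps_bounds n t0.
- by rewrite -[X in _ --> X]subr0; apply: cvgB; [exact: cvg_cst|exact: cvg_invS].
- exact: cvg_cst.
Qed.

Lemma steps_eq0 t n : t <= 0 -> steps t n = 0%N.
Proof.
move=> t0; apply/eqP; rewrite -leqn0 truncn_le_nat.
by rewrite (le_lt_trans _ ltr01)// mulr_le0_ge0.
Qed.

Hypothesis dense_domain : forall x e, 0 < e ->
  exists y eta, A y eta /\ `|x - y| < e.

Notation E n t x := (euler n.+1%:R^-1 (steps t n) x).

(** On the domain euler_dist provides a modulus of convergence; elsewhere the
    schemes are contractions and the domain is dense. *)
Lemma euler_cvg t x : cvgn (fun n => E n t x).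
Proof.
have [t0|/ltW t0] := leP t 0.
  rewrite (_ : (fun n => _) = fun=> x); first exact: is_cvg_cst.
  by apply/funext => n; rewrite steps_eq0.
have dom y eta : A y eta -> cvgn (fun n => E n t y).
  move=> Ay.
  pose f n := `|eta| ^+ 2 * (mesh n ^+ 2 + 2 * (t * mesh n)).
  apply: (@cauchy_modulus_cvg _ _ _ f).
    rewrite -(mulr0 (`|eta| ^+ 2)) /f; apply: cvgM; first exact: cvg_cst.
    rewrite -[X in _ --> X]addr0; apply: cvgD.
      by rewrite -(mulr0 0); apply: cvgM; exact: cvg_invS.
    rewrite -[X in _ --> X](mulr0 2); apply: cvgM; first exact: cvg_cst.
    by rewrite -(mulr0 t); apply: cvgM; [exact: cvg_cst|exact: cvg_invS].
  move=> n m nm; apply: le_trans (euler_dist _ _ (invS_gt0 m) (invS_gt0 n) Ay) _.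
  rewrite ler_wpM2l ?exprn_ge0//.
  have mn : m.+1%:R^-1 <= n.+1%:R^-1 :> R by rewrite lef_pV2 ?posrE// ler_nat.
  have key (p q h k : R) : t - h < p * h <= t -> t - k < q * k <= t -> 0 < k ->
      k <= h -> (q * k - p * h) ^+ 2 + q * k ^+ 2 + p * h ^+ 2 <=
      h ^+ 2 + 2 * (t * h).
    move=> /andP[p1 p2] /andP[q1 q2] k0 kh; have h0 := lt_le_trans k0 kh.
    have : 0 <= (h - (q * k - p * h)) * (h + (q * k - p * h)) by rewrite mulr_ge0; lra.
    have : p * h * h <= t * h by rewrite ler_wpM2r// ltW.
    have : q * k * k <= t * h.
      apply: (@le_trans _ _ (t * k)); first by rewrite ler_wpM2r// ltW.
      by rewrite ler_wpM2l.
    lra.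
  by apply: key => //; exact: steps_bounds.
apply/cauchy_cvgP/cauchy_exP => e e0.
have e30 : 0 < e / 2 by rewrite divr_gt0.
have [y [eta [Ay xy]]] := dense_domain x e30.
exists (lim (E n t y @[n --> \oo])).
have /cvgrPdist_lt/(_ _ e30) := dom y eta Ay.
apply: filterS => n yn; rewrite -ball_normE /=.
rewrite -(subrK (E n t y) (lim _)) -addrA (le_lt_trans (ler_normD _ _))//.
rewrite [e]splitr ltrD// distrC.
exact: le_lt_trans (euler_contraction _ _ _ (invS_gt0 n)) xy.
Qed.

(** The contraction semigroup generated by the opposite of A, extended by the
    identity to negative times. *)
Definition flow t x := lim (E n t x @[n --> \oo]).
Notation S := flow.

Lemma flow_cvg t x : E n t x @[n --> \oo] --> S t x.
Proof. exact: euler_cvg. Qed.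

Lemma flow_le0 t x : t <= 0 -> S t x = x.
Proof.
move=> t0; apply/cvg_lim => //.
rewrite (_ : (fun n => _) = fun=> x); first exact: cvg_cst.
by apply/funext => n; rewrite steps_eq0.
Qed.

Lemma flow_max0 t x : S t x = S (Num.max t 0) x.
Proof.
by have [t0|//] := leP t 0; rewrite (flow_le0 x t0) (flow_le0 x (lexx 0)).
Qed.

Lemma flow_contraction t x y : `|S t x - S t y| <= `|x - y|.
Proof.
have l : `|E n t x - E n t y| @[n --> \oo] --> `|S t x - S t y|.
  by apply: cvg_norm; apply: cvgB; exact: flow_cvg.
by apply: (cvgr_to_le l); apply: nearW => n; exact: euler_contraction (invS_gt0 n).
Qed.

Lemma cvg_sqr_norm (u : nat -> H) l a : u @ \oo --> l ->
  `|a - u n| ^+ 2 @[n --> \oo] --> `|a - l| ^+ 2.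
Proof.
move=> ul; have h : `|a - u n| @[n --> \oo] --> `|a - l|.
  by apply: cvg_norm; apply: cvgB => //; exact: cvg_cst.
exact: (cvgM h h).
Qed.

Lemma euler_flow_dist h k t x eta : 0 < h -> 0 <= t -> A x eta ->
  `|euler h k x - S t x| ^+ 2 <=
  `|eta| ^+ 2 * ((k%:R * h - t) ^+ 2 + k%:R * h ^+ 2).
Proof.
move=> h0 t0 Ax.
have l := @cvg_sqr_norm _ _ (euler h k x) (@flow_cvg t x).
pose f n := `|eta| ^+ 2 * ((k%:R * h - (steps t n)%:R * mesh n) ^+ 2 +
  k%:R * h ^+ 2 + (steps t n)%:R * mesh n ^+ 2).
have r : f @ \oo --> `|eta| ^+ 2 * ((k%:R * h - t) ^+ 2 + k%:R * h ^+ 2).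
  apply: cvgM; first exact: cvg_cst.
  rewrite -[X in _ --> X]addr0; apply: cvgD; last first.
    rewrite -(mulr0 t) (_ : (fun n => _) = fun n => (steps t n)%:R * mesh n * mesh n).
      by apply: cvgM; [exact: cvg_steps|exact: cvg_invS].
    by apply/funext => n; rewrite expr2 mulrA.
  apply: cvgD; last exact: cvg_cst.
  have d : k%:R * h - (steps t n)%:R * mesh n @[n --> \oo] --> k%:R * h - t.
    by apply: cvgB; [exact: cvg_cst|exact: cvg_steps].
  exact: (cvgM d d).
by apply: (ler_cvg_to l r); apply: nearW => n; exact: euler_dist (invS_gt0 n) Ax.
Qed.

Lemma cvg_euler_error (k : nat -> nat) (h : nat -> R) c s t :
  h @ \oo --> 0 -> (k n)%:R * h n @[n --> \oo] --> s ->
  c * (((k n)%:R * h n - t) ^+ 2 + (k n)%:R * h n ^+ 2) @[n --> \oo] -->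
    c * (s - t) ^+ 2.
Proof.
move=> h0 ks; apply: cvgM; first exact: cvg_cst.
rewrite -[X in _ --> X]addr0; apply: cvgD; last first.
  rewrite -(mulr0 s) (_ : (fun n => _) = fun n => (k n)%:R * h n * h n).
    by apply: cvgM.
  by apply/funext => n; rewrite expr2 mulrA.
have d : (k n)%:R * h n - t @[n --> \oo] --> s - t.
  by apply: cvgB => //; exact: cvg_cst.
exact: (cvgM d d).
Qed.

Lemma flow_lipschitz s t x eta : A x eta ->
  `|S s x - S t x| <= `|eta| * `|s - t|.
Proof.
move=> Ax; wlog s0 : s t / 0 <= s /\ 0 <= t.
  move=> wl; rewrite (flow_max0 s) (flow_max0 t).
  apply: le_trans (wl (Num.max s 0) (Num.max t 0) _) _.
    by rewrite !le_max !lexx !orbT.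
  rewrite ler_wpM2l//.
  have h1 := ler_norm (s - t); have := ler_norm (t - s); rewrite distrC => h2.
  rewrite ler_norml.
  by case: (leP s 0) => s0; case: (leP t 0) => t0; lra.
case: s0 => s0 t0.
rewrite -(@ler_pXn2r _ 2) ?nnegrE ?mulr_ge0// exprMn real_normK ?num_real//.
rewrite distrC.
have l := @cvg_sqr_norm _ _ (S t x) (@flow_cvg s x).
pose f n := `|eta| ^+ 2 * (((steps s n)%:R * mesh n - t) ^+ 2 +
  (steps s n)%:R * mesh n ^+ 2).
have r : f @ \oo --> `|eta| ^+ 2 * (s - t) ^+ 2.
  by apply: cvg_euler_error; [exact: cvg_invS|exact: cvg_steps].
apply: (ler_cvg_to l r); apply: nearW => n; rewrite distrC.
exact: euler_flow_dist (invS_gt0 n) t0 Ax.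
Qed.

Lemma euler_cvg_flow (h : nat -> R) (k : nat -> nat) t x eta :
  0 <= t -> A x eta -> (forall n, 0 < h n) -> h @ \oo --> 0 ->
  (k n)%:R * h n @[n --> \oo] --> t -> euler (h n) (k n) x @[n --> \oo] --> S t x.
Proof.
move=> t0 Ax hp h0 kt; apply/cvgrPdist_le => e e0.
pose f n := `|eta| ^+ 2 * (((k n)%:R * h n - t) ^+ 2 + (k n)%:R * h n ^+ 2).
have r : f @ \oo --> 0.
  have := @cvg_euler_error k h (`|eta| ^+ 2) t t h0 kt.
  by rewrite subrr expr0n/= mulr0.
have e20 : 0 < e ^+ 2 by rewrite exprn_gt0.
have /cvgr_le/(_ _ e20) := r; apply: filterS => n fn.
rewrite -(@ler_pXn2r _ 2) ?nnegrE ?(ltW e0)// distrC.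
exact: le_trans (euler_flow_dist (k n) (hp n) t0 Ax) fn.
Qed.

(** The Yosida approximations selected along the scheme do not grow in norm. *)
Lemma flow_domain t x eta : A x eta ->
  exists zeta, A (S t x) zeta /\ `|zeta| <= `|eta|.
Proof.
move=> Ax; have h n := euler_domain (steps t n) (invS_gt0 n) Ax.
pose v n := projT1 (cid (h n)).
apply: (domain_limit hip mA rA (v := v) (@flow_cvg t x)) => n.
by rewrite /v; case: cid.
Qed.

(** Running the scheme during s and then during t is a scheme for s + t, up to
    one step, which euler_cvg_flow does not notice. *)
Lemma flow_semigroup s t x : 0 <= s -> 0 <= t -> S (s + t) x = S t (S s x).
Proof.
move=> s0 t0.
have dom y eta : A y eta -> S (s + t) y = S t (S s y).
  move=> Ay; have [zeta [Az _]] := flow_domain s Ay.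
  pose k n := (steps t n + steps s n)%N.
  have c1 : euler (mesh n) (k n) y @[n --> \oo] --> S (s + t) y.
    apply: (euler_cvg_flow _ Ay) => //; [exact: addr_ge0|exact: cvg_invS|].
    rewrite (_ : (fun n => _) = fun n => (steps s n)%:R * mesh n + (steps t n)%:R * mesh n).
      by apply: cvgD; exact: cvg_steps.
    by apply/funext => n; rewrite -mulrDl -natrD addnC.
  suff c2 : euler (mesh n) (k n) y @[n --> \oo] --> S t (S s y).
    exact: (cvg_unique _ c1 c2).
  rewrite -[X in _ --> X]add0r.
  rewrite (_ : (fun n => _) = fun n =>
     (euler (mesh n) (k n) y - E n t (S s y)) + E n t (S s y)); last first.
    by apply/funext => n; rewrite subrK.
  apply: cvgD; last exact: flow_cvg.
  apply/norm_cvg0P; apply: (@squeeze_cvgr nat \oo _ R (fun=> 0) (fun n => `|E n s y - S s y|)).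
  - apply: nearW => n; rewrite normr_ge0/= /k /euler iterD.
    exact: (euler_contraction _ _ _ (invS_gt0 n)).
  - exact: cvg_cst.
  - rewrite -(@normr0 _ H) -(subrr (S s y)); apply: cvg_norm; apply: cvgB.
      exact: flow_cvg.
    exact: cvg_cst.
apply/eqP; rewrite -subr_eq0 -normr_le0; apply/ler_addgt0Pl => e e0.
have e20 : 0 < e / 2 by rewrite divr_gt0.
have [y [eta [Ay xy]]] := dense_domain x e20.
rewrite addr0 -(subrK (S (s + t) y) (S (s + t) x)) -addrA.
rewrite (le_trans (ler_normD _ _))// [e]splitr lerD//.
  exact: le_trans (flow_contraction _ _ _) (ltW xy).
rewrite (dom y eta Ay) (le_trans (flow_contraction _ _ _))//.
by rewrite (le_trans (flow_contraction _ _ _))// distrC ltW.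
Qed.

Lemma flow_continuous x : continuous (S ^~ x).
Proof.
move=> t; apply/cvgrPdist_le => e e0.
have e30 : 0 < e / 3 by rewrite divr_gt0.
have [y [eta [Ay xy]]] := dense_domain x e30.
have c : `|eta| * `|t - s| @[s --> t] --> `|eta| * `|t - t|.
  apply: cvgM; first exact: cvg_cst.
  by apply: cvg_norm; apply: cvgB => //; exact: cvg_cst.
rewrite subrr normr0 mulr0 in c.
have /cvgr_le/(_ _ e30) := c; apply: filterS => s ts.
have -> : S t x - S s x = (S t x - S t y) + (S t y - S s y) + (S s y - S s x).
  by rewrite !addrA !subrK.
have -> : e = e / 3 + e / 3 + e / 3 by field.
rewrite (le_trans (ler_normD _ _))// lerD//.
  rewrite (le_trans (ler_normD _ _))// lerD//.
    exact: le_trans (flow_contraction _ _ _) (ltW xy).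
  exact: le_trans (flow_lipschitz _ _ Ay) ts.
by rewrite (le_trans (flow_contraction _ _ _))// distrC ltW.
Qed.

End euler.

(** * The right derivative of the flow *)

Lemma cvg_dnbhs (R : realType) (V : normedModType R) (f : R -> V) (p : R) (l : V) :
  f x @[x --> p^'+] --> l -> f x @[x --> p^'-] --> l -> f x @[x --> p^'] --> l.
Proof.
move=> fr fl U lU; have /nbhs_ballP[a /= a0 ha] := fr _ lU.
have /nbhs_ballP[b /= b0 hb] := fl _ lU.
apply/nbhs_ballP; exists (Num.min a b); first by rewrite /= lt_min a0.
move=> x; rewrite -ball_normE/= lt_min => /andP[xa xb].
by rewrite neq_lt => /orP[xp|px]; [apply: hb|apply: ha]; rewrite -?ball_normE.
Qed.

Section flow_derivative.
Context (R : realType) (H : completeNormedModType R) (ip : H -> H -> R).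
Hypothesis hip : inner_product ip.
Context (A : H -> set H).
Hypothesis mA : monotone_graph ip A.
Hypothesis rA : full_range A.
Hypothesis dense_domain : forall x e, 0 < e ->
  exists y eta, A y eta /\ `|x - y| < e.
Notation J := (resolvent A).
Notation Y := (yosida A).
Notation A0 := (min_section A).
Notation S := (flow A).
Implicit Types (h s t : R) (x y z xi eta zeta : H).

(** Each increment of the scheme is a multiple of an element of the graph, to
    which yosida_angle applies; the increments are summed. *)
Lemma euler_angle l k h y eta z e : 0 < l -> 0 < h -> A y eta ->
  `|y - z| + `|eta| * (k%:R * l) <= e ->
  k%:R * l * (`|Y h z| ^+ 2 - (`|eta| + `|Y h z|) * e / h) <=
  ip (y - euler A l k y) (Y h z).
Proof.
move=> l0 h0 Ay; elim: k => [|k IH] ke.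
  by rewrite !mul0r subrr (ip0l hip).
have d0 : 0 <= `|eta| * l by rewrite mulr_ge0// ltW.
have {}IH := IH _; set B := (X in _ * X <= _) in IH *.
rewrite -natr1 in ke.
have ke' : `|y - z| + `|eta| * (k%:R * l) <= e by lra.
have Eu : euler A l k.+1 y = euler A l k y - l *: Y l (euler A l k y).
  by rewrite [LHS](resolvent_eq A _ l0).
have [zeta [Az ze]] := euler_domain hip mA rA k l0 Ay.
have Yl := yosida_le hip mA rA l0 Az.
have dz : `|euler A l k.+1 y - z| <= e.
  rewrite -(subrK y (euler A l k.+1 y)) -addrA (le_trans (ler_normD _ _))//.
  by have := euler_dist0 hip mA rA k.+1 l0 Ay; rewrite -natr1; lra.
have an := yosida_angle hip mA rA h0 (yosida_in rA (euler A l k y) l0) dz.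
have -> : y - euler A l k.+1 y = (y - euler A l k y) + l *: Y l (euler A l k y).
  by rewrite Eu opprB addrCA addrC.
rewrite (ipDl hip) (ipZl hip); set v := Y l _ in Yl an *.
have e0 : 0 <= e by rewrite (le_trans _ ke')// addr_ge0// mulr_ge0// mulr_ge0// ltW.
have Bv : B <= ip v (Y h z).
  apply: le_trans an; rewrite lerD2l lerN2 ler_pM2r ?invr_gt0// ler_wpM2r//.
  by rewrite lerD2r (le_trans Yl).
have := IH ke'.
have := ler_wpM2l (ltW l0) Bv.
by rewrite -natr1 mulrDl mul1r mulrDl -/B; lra.
Qed.

(** Difference quotients of the flow obey the angle condition of yosida_angle,
    just as elements of A do, and min_section_near applies to both. *)
Lemma flow_angle t h y eta z e : 0 <= t -> 0 < h -> A y eta ->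
  `|y - z| + `|eta| * t <= e ->
  t * (`|Y h z| ^+ 2 - (`|eta| + `|Y h z|) * e / h) <= ip (y - S t y) (Y h z).
Proof.
move=> t0 h0 Ay ye.
have c1 : ip (y - euler A n.+1%:R^-1 (steps t n) y) (Y h z) @[n --> \oo]
    --> ip (y - S t y) (Y h z).
  apply: (cvg_ip hip); last exact: cvg_cst.
  by apply: cvgB; [exact: cvg_cst|exact: (flow_cvg hip mA rA dense_domain)].
have c2 : (steps t n)%:R * n.+1%:R^-1 *
      (`|Y h z| ^+ 2 - (`|eta| + `|Y h z|) * e / h) @[n --> \oo]
    --> t * (`|Y h z| ^+ 2 - (`|eta| + `|Y h z|) * e / h).
  by apply: cvgM; [exact: cvg_steps|exact: cvg_cst].
apply: (ler_cvg_to c2 c1); apply: nearW => n; apply: euler_angle => //.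
rewrite (le_trans _ ye)// lerD2l ler_wpM2l//.
by have /andP[_] := steps_bounds n t0.
Qed.

Lemma graph_near x xi e : A x xi -> 0 < e ->
  exists d, 0 < d /\ forall y eta, A y eta -> `|eta| <= `|A0 x| + d ->
    `|y - x| <= d -> `|eta - A0 x| <= e.
Proof.
move=> Ax e0; have [d [d0 hd]] := min_section_near hip mA rA Ax e0.
exists d; split => // y eta Ay etad yd.
apply: (hd eta `|eta| `|y - x|) => //; first by rewrite normr_ge0.
by move=> h h0; have := yosida_angle hip mA rA h0 Ay (lexx _); apply.
Qed.

Lemma flow_near x xi e : A x xi -> 0 < e ->
  exists d, 0 < d /\ forall y eta t, A y eta -> `|eta| <= `|A0 x| + d ->
    0 < t -> `|y - x| + `|eta| * t <= d ->
    `|t^-1 *: (y - S t y) - A0 x| <= e.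
Proof.
move=> Ax e0; have [d [d0 hd]] := min_section_near hip mA rA Ax e0.
exists d; split => // y eta t Ay etad t0 yd.
apply: (hd _ `|eta| (`|y - x| + `|eta| * t)) => //.
- rewrite normrZ gtr0_norm ?invr_gt0// ler_pdivrMl// mulrC.
  have := flow_lipschitz hip mA rA dense_domain 0 t Ay.
  by rewrite flow_le0// sub0r normrN gtr0_norm.
- by rewrite yd addr_ge0// mulr_ge0// ltW.
- move=> h h0; rewrite (ipZl hip) ler_pdivlMl//.
  by apply: flow_angle => //; exact: ltW.
Qed.

Lemma flow_right_derivative x t xi : 0 <= t -> A (S t x) xi ->
  right_derivative (S ^~ x) t (- A0 (S t x)).
Proof.
move=> t0 Ax; rewrite /right_derivative; apply/cvgrPdist_le => e e0.
have [d [d0 hd]] := flow_near Ax e0.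
have [AA0 _] := min_sectionP hip mA rA Ax.
pose r := d / (`|A0 (S t x)| + 1).
have r0 : 0 < r by rewrite divr_gt0// ltr_wpDl.
near=> h.
have h0 : 0 < h by near: h; exact: nbhs_right_gt.
have hr : h <= r by near: h; exact: nbhs_right_le.
rewrite (flow_semigroup hip mA rA dense_domain)// ?(ltW h0)//.
set z := S t x; rewrite -(opprB z) scalerN opprK addrC.
apply: hd AA0 _ h0 _; first by rewrite lerDl ltW.
rewrite subrr normr0 add0r.
apply: (@le_trans _ _ ((`|A0 z| + 1) * r)); last by rewrite /r mulrC divfK// gt_eqF// ltr_wpDl.
by rewrite ler_pM ?(ltW h0)// lerDl.
Unshelve. all: by end_near. Qed.

Lemma flow_regular x s t xi : A (S s x) xi -> 0 <= s <= t ->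
  A (S t x) (A0 (S t x)) /\ `|A0 (S t x)| <= `|A0 (S s x)|.
Proof.
move=> Ax /andP[s0 st]; have [Az0 _] := min_sectionP hip mA rA Ax.
have [w [Aw wz]] := flow_domain hip mA rA dense_domain (t - s) Az0.
rewrite -(flow_semigroup hip mA rA dense_domain) ?subr_ge0// in Aw.
rewrite addrC subrK in Aw; have [? /(_ _ Aw) wm] := min_sectionP hip mA rA Aw.
by split => //; exact: le_trans wm wz.
Qed.

(** The speed of the flow never increases, so that graph_near applies to all
    later points. *)
Lemma min_section_right_continuous x xi t : A (S t x) xi -> 0 <= t ->
  A0 (S s x) @[s --> t^'+] --> A0 (S t x).
Proof.
move=> At t0; apply/cvgrPdist_le => e e0.
have [d [d0 hd]] := graph_near At e0.
have /cvgrPdist_le/(_ _ d0) c : S s x @[s --> t^'+] --> S t x.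
  exact/cvg_at_right_filter/(flow_continuous hip mA rA dense_domain).
near=> s.
have ts : t < s by near: s; exact: nbhs_right_gt.
have [|As ms] := @flow_regular x t s _ At; first by rewrite t0 ltW.
rewrite distrC; apply: hd As _ _; first by rewrite (le_trans ms)// lerDl ltW.
by rewrite distrC; near: s; exact: c.
Unshelve. all: by end_near. Qed.

(** The flow is differentiable wherever its speed is continuous from the left:
    the left difference quotients start at earlier points, whose speed is then
    barely larger than the speed at t. *)
Lemma flow_derivative x xi a t : 0 <= a < t -> A (S a x) xi ->
  `|A0 (S s x)| @[s --> t^'-] --> `|A0 (S t x)| ->
  h^-1 *: (S (t + h) x - S t x) @[h --> 0^'] --> - A0 (S t x).
Proof.
move=> /andP[a0 at_] Ax lc.
have [|At _] := @flow_regular x a t _ Ax; first by rewrite a0 ltW.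
apply: cvg_dnbhs.
  by apply: flow_right_derivative At; lra.
apply/cvgrPdist_le => e e0.
have [d [d0 hd]] := flow_near At e0.
have /cvgrPdist_le/(_ _ d0)/nbhs_ballP[r /= r0 hr] := lc.
pose M := `|A0 (S a x)|.
have M0 : 0 < M + 1 by rewrite ltr_wpDl// normr_ge0.
pose w := Num.min (Num.min r (t - a)) (d / (2 * (M + 1))).
have w0 : 0 < w by rewrite !lt_min r0 subr_gt0 at_ divr_gt0// mulr_gt0.
have wr : w <= r by rewrite !ge_min lexx.
have wt : w <= t - a by rewrite !ge_min lexx orbT.
have wd : 2 * ((M + 1) * w) <= d.
  by rewrite mulrA -ler_pdivlMl ?mulr_gt0// mulrC !ge_min lexx orbT.
near=> h.
have h0 : h < 0 by near: h; exact: nbhs_left_lt.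
have hw : - w < h by near: h; apply: nbhs_left_gt; rewrite oppr_lt0.
have ath : 0 <= a <= t + h by lra.
have [Ath spdth] := flow_regular Ax ath.
have nh0 : 0 < - h by lra.
have St : S t x = S (- h) (S (t + h) x).
  rewrite -(flow_semigroup hip mA rA dense_domain) ?(ltW nh0)//; last by lra.
  by rewrite addrK.
have dist : `|S (t + h) x - S t x| <= M * - h.
  have := flow_lipschitz hip mA rA dense_domain 0 (- h) Ath.
  rewrite -St (flow_le0 _ _ (lexx 0)) sub0r opprK ltr0_norm//.
  by move=> /le_trans; apply; rewrite ler_wpM2r// ltW.
have -> : - A0 (S t x) - h^-1 *: (S (t + h) x - S t x) =
    (- h)^-1 *: (S (t + h) x - S (- h) (S (t + h) x)) - A0 (S t x).
  by rewrite -St invrN scaleNr addrC.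
have hM : `|A0 (S (t + h) x)| * - h <= (M + 1) * w.
  by rewrite ler_pM ?(ltW nh0)//; [rewrite (le_trans spdth)// lerDl|lra].
apply: hd Ath _ nh0 _.
  have : `|(`|A0 (S t x)| - `|A0 (S (t + h) x)|)| <= d.
    apply: hr; last by rewrite gtrDl.
    by rewrite -ball_normE/= opprD addNKr ltr_norml; lra.
  by rewrite ler_norml; lra.
have : M * - h <= (M + 1) * w by rewrite ler_pM ?normr_ge0 ?(ltW nh0)//; lra.
lra.
Unshelve. all: by end_near. Qed.

End flow_derivative.

(** * Homogeneous operators and smoothing *)

Section smoothing.
Context (R : realType) (H : completeNormedModType R) (ip : H -> H -> R).
Hypothesis hip : inner_product ip.
Context (A : H -> set H).
Hypothesis mA : monotone_graph ip A.
Hypothesis rA : full_range A.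
Hypothesis dense_domain : forall x e, 0 < e ->
  exists y eta, A y eta /\ `|x - y| < e.
Hypothesis hA : forall c x eta, 0 < c -> A x eta -> A (c *: x) eta.
Hypothesis A00 : A 0 0.
Notation J := (resolvent A).
Notation A0 := (min_section A).
Notation S := (flow A).
Implicit Types (h s t c : R) (x y z xi eta zeta : H).

Lemma resolvent_homogeneous c h x : 0 < c -> 0 < h ->
  J (c * h) (c *: x) = c *: J h x.
Proof.
move=> c0 h0; apply/esym/(resolvent_unique hip mA rA); first exact: mulr_gt0.
rewrite -scalerBr scalerA invfM -mulrA mulrCA mulVf ?gt_eqF// mulr1.
by apply: hA => //; exact: yosida_in.
Qed.

Lemma euler_homogeneous c h k x : 0 < c -> 0 < h ->
  euler A (c * h) k (c *: x) = c *: euler A h k x.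
Proof.
move=> c0 h0; rewrite /euler; elim: k => //= k ->.
exact: resolvent_homogeneous.
Qed.

Lemma flow_homogeneous c t x xi : A x xi -> 0 < c -> 0 <= t ->
  S (c * t) (c *: x) = c *: S t x.
Proof.
move=> Ax c0 t0.
have c1 : euler A (c * n.+1%:R^-1) (steps t n) (c *: x) @[n --> \oo] -->
    S (c * t) (c *: x).
  apply: (euler_cvg_flow hip mA rA dense_domain _ (hA c0 Ax)).
  - by rewrite mulr_ge0// ltW.
  - by move=> n; rewrite mulr_gt0.
  - rewrite -[X in _ --> X](mulr0 c).
    by apply: cvgM; [exact: cvg_cst|exact: cvg_harmonic].
  - rewrite (_ : (fun n => _) = fun n => c * ((steps t n)%:R * n.+1%:R^-1)).
      by apply: cvgM; [exact: cvg_cst|exact: cvg_steps].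
    by apply/funext => n; rewrite mulrCA.
have c2 : euler A (c * n.+1%:R^-1) (steps t n) (c *: x) @[n --> \oo] -->
    c *: S t x.
  rewrite (_ : (fun n => _) = fun n => c *: euler A n.+1%:R^-1 (steps t n) x).
    by apply: cvgZ; [exact: cvg_cst|exact: (flow_cvg hip mA rA dense_domain)].
  by apply/funext => n; rewrite euler_homogeneous.
exact: (cvg_unique _ c1 c2).
Qed.

Lemma flow0 t : S t 0 = 0.
Proof.
have := flow_lipschitz hip mA rA dense_domain t 0 A00.
by rewrite normr0 mul0r (flow_le0 _ _ (lexx 0)) subr0 normr_le0 => /eqP.
Qed.

Lemma flow_norm t x : `|S t x| <= `|x|.
Proof.
by have := flow_contraction hip mA rA dense_domain t x 0; rewrite flow0 !subr0.
Qed.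

(** Running the flow for a slightly longer time amounts, by homogeneity, to
    rescaling the initial datum, and the flow is a contraction. *)
Lemma flow_time_scaling t a x xi : A x xi -> 0 <= t -> 0 < a ->
  `|S (t + a * t) x - S t x| <= 2 * (a * `|x|).
Proof.
move=> Ax t0 a0; have a1 : 0 < 1 + a by lra.
have a2 : 0 < (1 + a)^-1 by rewrite invr_gt0.
have xE : x = (1 + a) *: ((1 + a)^-1 *: x) by rewrite scalerA mulfV ?gt_eqF// scale1r.
have -> : S (t + a * t) x = (1 + a) *: S t ((1 + a)^-1 *: x).
  rewrite -{1}[t]mul1r -mulrDl {1}xE.
  exact: (flow_homogeneous (hA a2 Ax)).
set y := (1 + a)^-1 *: x in xE *.
have -> : (1 + a) *: S t y - S t x = (1 + a) *: (S t y - S t x) + a *: S t x.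
  by apply: (eq_ip hip) => z; rewrite !(ipE hip); ring.
rewrite (le_trans (ler_normD _ _))// mulrDl mul1r lerD//; last first.
  by rewrite normrZ gtr0_norm// ler_wpM2l ?flow_norm// ltW.
rewrite normrZ gtr0_norm//.
apply: (@le_trans _ _ ((1 + a) * `|y - x|)).
  by rewrite ler_wpM2l ?(ltW a1)// (flow_contraction hip mA rA dense_domain).
rewrite -[1 + a]gtr0_norm// -normrZ scalerBr -xE.
have -> : x - (1 + a) *: x = - (a *: x) by rewrite scalerDl scale1r opprD addNKr.
by rewrite normrN normrZ gtr0_norm.
Qed.

(** The smoothing effect of homogeneity: flow_time_scaling bounds the speed of
    a trajectory issued from the domain by the norm of its initial datum, and
    domain_limit extends this to all data; the + 1 leaves room for the
    approximation. *)
Lemma flow_smoothing t x : 0 < t ->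
  exists eta, A (S t x) eta /\ `|eta| <= 2 * (`|x| + 1) / t.
Proof.
move=> t0.
have dom y xi : A y xi -> `|A0 (S t y)| <= 2 * `|y| / t.
  move=> Ay; have [z [Az _]] := flow_domain hip mA rA dense_domain t Ay.
  have [At _] := min_sectionP hip mA rA Az.
  have rd := flow_right_derivative hip mA rA dense_domain (ltW t0) At.
  have rdn : `|h^-1 *: (S (t + h) y - S t y)| @[h --> 0^'+] --> `|- A0 (S t y)|.
    exact: cvg_norm rd.
  rewrite -normrN; apply: (cvgr_to_le rdn).
  near=> h.
  have h0 : 0 < h by near: h; exact: nbhs_right_gt.
  rewrite normrZ gtr0_norm ?invr_gt0// ler_pdivrMl//.
  have ht : 0 < h / t by rewrite divr_gt0.
  have := flow_time_scaling Ay (ltW t0) ht.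
  by rewrite divfK ?gt_eqF// => /le_trans; apply; rewrite le_eqVlt; apply/orP; left;
    apply/eqP; field; rewrite gt_eqF.
have ex n : exists y eta, A y eta /\ `|x - y| < n.+1%:R^-1.
  by apply: dense_domain; rewrite invr_gt0.
pose y n := projT1 (cid (ex n)).
have [xi yP] : {xi : nat -> H & forall n, A (y n) (xi n) /\ `|x - y n| < n.+1%:R^-1}.
  by apply: (@choice _ _ (fun n e => A (y n) e /\ `|x - y n| < n.+1%:R^-1)) => n;
    rewrite /y; case: cid.
apply: (domain_limit hip mA rA (u := fun n => S t (y n)) (v := fun n => A0 (S t (y n)))).
  apply/cvgrPdist_le => e e0.
  have /cvgr_le/(_ _ e0) := @cvg_harmonic R; apply: filterS => n /= ne.
  apply: le_trans (flow_contraction hip mA rA dense_domain _ _ _) _.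
  by apply: ltW; apply: lt_le_trans ne; case: (yP n).
move=> n; have [Ay xy] := yP n; split.
  have [z [Az _]] := flow_domain hip mA rA dense_domain t Ay.
  by have [] := min_sectionP hip mA rA Az.
apply: (le_trans (dom _ _ Ay)); rewrite ler_pM2r ?invr_gt0// ler_pM2l//.
rewrite -(subrK x (y n)) (le_trans (ler_normD _ _))// addrC lerD2l distrC.
apply: ltW; apply: lt_le_trans xy _.
by rewrite invf_le1// ler1n.
Unshelve. all: by end_near. Qed.

End smoothing.

(** * Membership in W^(1,oo) *)

Section W1infty.
Context (R : realType) (X : normedModType R).
Implicit Types (u w : R -> X) (a b t : R).

Lemma lipschitz_absolutely_continuous a b u L :
  (forall s t, a <= s <= b -> a <= t <= b -> `|u s - u t| <= L * `|s - t|) ->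
  absolutely_continuous a b u.
Proof.
move=> uL e e0.
pose K := `|L| + 1.
have K0 : 0 < K by rewrite ltr_wpDl.
exists (e / K); first by rewrite divr_gt0.
move=> n s t st _ sum_lt.
apply: (@le_lt_trans _ _ (K * \sum_(i < n) (t i - s i))); last first.
  by rewrite mulrC -ltr_pdivlMr.
rewrite mulr_sumr; apply: ler_sum => i _; have [as_ sti tb] := st i.
apply: le_trans (uL _ _ _ _) _.
- by rewrite tb (le_trans as_).
- by rewrite as_ (le_trans sti).
rewrite ger0_norm ?subr_ge0// ler_wpM2r ?subr_ge0//.
by rewrite /K (le_trans (ler_norm _))// lerDl.
Qed.

(** Sampling w at the right end of the grid cell of t gives simple functions,
    which converge to w t because w is continuous from the right. *)
Lemma right_continuous_strongly_measurable a b u w Z :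
  (forall t, a < t < b -> w s @[s --> t^'+] --> w t) ->
  countable Z -> (forall t, a < t < b -> ~ Z t -> u t = w t) ->
  strongly_measurable `]a, b[ u.
Proof.
move=> wr cZ uw.
pose grid n k : R := a + k.+1%:R / n.+1%:R.
pose idx n t := Num.truncn ((t - a) * n.+1%:R).
pose s n t := if t \in `]a, b[%classic then w (grid n (idx n t)) else 0.
exists s; split.
  move=> n; split.
    pose K := Num.truncn ((b - a) * n.+1%:R).
    apply: (@sub_finite_set _ _ ((fun k => w (grid n k)) @` `I_K.+1 `|` [set 0])).
      move=> _ [t _ <-]; rewrite /s; case: ifPn; last by right.
      rewrite inE/= in_itv/= => /andP[at_ tb]; left; exists (idx n t) => //=.
      by rewrite ltnS; apply: le_truncn; rewrite ler_pM2r// lerD2r ltW.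
    by rewrite finite_setU; split; [exact/finite_image/finite_II|exact: finite_set1].
  move=> y.
  have mk k : measurable (`]a, b[%classic `&` idx n @^-1` [set k] : set R).
    rewrite (_ : _ `&` _ = `]a, b[%classic `&`
        `[a + k%:R / n.+1%:R, a + k.+1%:R / n.+1%:R[%classic).
      by apply: measurableI; exact: measurable_itv.
    apply/seteqP; split => t /= [ab]; move: (ab); rewrite !in_itv/= => /andP[at_ tb];
      rewrite /idx ?in_itv/=.
      move=> /eqP; rewrite truncn_eq ?mulr_ge0 ?subr_ge0 ?(ltW at_)//.
      by rewrite -lerBrDl -ltrBlDl ler_pdivrMr// ltr_pdivlMr.
    rewrite -lerBrDl -ltrBlDl ler_pdivrMr// ltr_pdivlMr// => h; split => //.
    by apply/eqP; rewrite truncn_eq ?mulr_ge0 ?subr_ge0 ?(ltW at_).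
  rewrite (_ : _ @^-1` _ = \bigcup_(k in [set k | w (grid n k) = y])
      (`]a, b[%classic `&` idx n @^-1` [set k])
     `|` (if 0 == y then ~` `]a, b[%classic else set0)).
    apply: measurableU; first exact: bigcup_measurable.
    by case: ifP => _ //; apply: measurableC; exact: measurable_itv.
  apply/seteqP; split => t /=; rewrite /s.
    case: ifPn => [tab <-|tab <-]; first by left; exists (idx n t) => //; split => //; exact/set_mem.
    by right; rewrite eqxx; by move=> /mem_set; apply/negP.
  case=> [[k /= wk [tab kt]]|]; first by rewrite mem_set// kt.
  by case: eqP => // <- /mem_set; rewrite in_setC; case: ifPn.
exists Z; split; [|exact: countable_lebesgue_measure0|].
  by apply: countable_measurable => // r; exact: measurable_set1.
move=> t /=; apply: contra_notP => Zt tab.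
have tab' : a < t < b by move: tab; rewrite /= in_itv.
rewrite (uw t tab' Zt).
have -> : (fun n => s n t) = fun n => w (grid n (idx n t)).
  by apply/funext => n; rewrite /s mem_set.
apply: (cvg_comp (fun n => grid n (idx n t)) w _ (wr _ tab')).
move=> U /nbhs_ballP[e /= e0 hU].
have /cvgr_lt/(_ _ e0) := @cvg_harmonic R; apply: filterS => n /= ne.
have at_ : a < t by case/andP: tab'.
have n0 : 0 < n.+1%:R :> R by [].
have tn : 0 <= (t - a) * n.+1%:R by rewrite mulr_ge0// subr_ge0 ltW.
have /andP[k1 k2] := truncn_itv tn.
have tg : t < grid n (idx n t).
  by rewrite /grid -ltrBlDl ltr_pdivlMr.
have gt : grid n (idx n t) <= t + n.+1%:R^-1.
  rewrite /grid -natr1 mulrDl mul1r addrA lerD2r -lerBrDl ler_pdivrMr//.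
by apply: hU => //=; rewrite -ball_normE/= ltr0_norm ?subr_lt0// opprB ltrBlDl (le_lt_trans gt)// ltrD2l.
Qed.

(** A Lipschitz function with values in X need not be differentiable almost
    everywhere, so a candidate w for the derivative is required. *)
Lemma W1infty_intro a b u w L Z :
  (forall s t, a <= s <= b -> a <= t <= b -> `|u s - u t| <= L * `|s - t|) ->
  (forall t, a < t < b -> `|w t| <= L) ->
  (forall t, a < t < b -> w s @[s --> t^'+] --> w t) ->
  countable Z ->
  (forall t, a < t < b -> ~ Z t ->
    h^-1 *: (u (t + h) - u t) @[h --> 0^'] --> w t) ->
  W1infty a b u.
Proof.
move=> uL wL wr cZ du.
have aeZ (P : set R) : (forall t, ~ Z t -> P t) -> \forall t \ae lebesgue_measure, P t.
  move=> ZP; exists Z; split; [by apply: countable_measurable => // r; exact: measurable_set1|exact: countable_lebesgue_measure0|].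
  by move=> t /=; apply: contra_notP => /ZP.
have duE t : a < t < b -> ~ Z t -> derivable u t 1 /\ derive1 u t = w t.
  move=> tab Zt; have dut := du t tab Zt.
  have dt : (fun h : R => h^-1 *: ((u \o shift t) (h *: (1 : R)) - u t)) @ 0^' --> w t.
    have -> : (fun h : R => h^-1 *: ((u \o shift t) (h *: (1 : R)) - u t)) =
        (fun h => h^-1 *: (u (t + h) - u t)).
      by apply/funext => h /=; rewrite -[h *: 1]/(h * 1) mulr1 (addrC h).
    exact: dut.
  split; first by apply/cvg_ex; exists (w t).
  by rewrite derive1E; apply: cvg_lim.
split.
- exact: lipschitz_absolutely_continuous uL.
- by apply: aeZ => t Zt /=; rewrite in_itv => /= tab; have [] := duE t tab Zt.
- split.
    by apply: right_continuous_strongly_measurable wr cZ _ => t tab /(duE t tab)[].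
  exists L; apply: aeZ => t Zt /=; rewrite in_itv => /= tab.
  by have [_ ->] := duE t tab Zt; exact: wL.
Qed.

(** Applied to the speed of the flow, this leaves countably many times at which
    the flow may fail to be differentiable. *)
Lemma nonincreasing_left_continuous (f : R -> R) a b :
  (forall s t, a <= s -> s <= t -> f t <= f s) ->
  (forall t, a < t -> f s @[s --> t^'+] --> f t) ->
  exists Z : set R, countable Z /\
    forall t, a < t < b -> ~ Z t -> f s @[s --> t^'-] --> f t.
Proof.
move=> nf rf.
pose g t := - f t.
have ng : {in `[a, b] &, nondecreasing_fun g}.
  move=> s t; rewrite !in_itv/= => /andP[as_ _] _ st; rewrite lerN2.
  exact: nf.
exists [set x | x \in (`]a, b[) /\ discontinuity g x]; split.
  exact: discontinuity_countable.
move=> t /andP[at_ tb] Zt.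
have cl : cvg (g x @[x --> t^'-]).
  apply: nondecreasing_at_left_is_cvgr.
    near=> x; move=> s s' /=; rewrite !in_itv/= => /andP[xs _] _ ss'.
    rewrite lerN2; apply: nf => //.
    by apply: le_trans (ltW xs); near: x; exact: nbhs_left_ge.
  near=> x; exists (g t) => _ [s /=] + <-; rewrite in_itv/= => /andP[xs st].
  rewrite lerN2; apply: nf; last exact: ltW.
  by apply: le_trans (ltW xs); near: x; exact: nbhs_left_ge.
have cr : g x @[x --> t^'+] --> g t by apply: cvgN; exact: rf.
have El : lim (g x @[x --> t^'-]) = g t.
  rewrite -(cvg_lim _ cr)//; apply/eqP; apply: contra_notT Zt => ne.
  split; first by rewrite in_itv/= at_.
  by split => //; apply/cvg_ex; exists (g t).
have gl : g x @[x --> t^'-] --> g t by rewrite -El.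
have fE : f = (fun s => - g s) by apply/funext => s; rewrite /g opprK.
by rewrite fE; exact: cvgN gl.
Unshelve. all: by end_near. Qed.

End W1infty.

(** * Well-posedness of the evolution inclusion *)

(** Without left derivatives the mean value theorem is not available. But if f
    is tilted by - k * x with k > 0, a minimum point of the result on [s, t]
    other than t would be a point where f has a right derivative at least k. *)
Lemma right_derivative_le0_nonincreasing (R : realType) (f : R -> R) (T : R) :
  0 < T -> {within `[0, T], continuous f} ->
  (forall t, 0 < t < T -> exists2 l, l <= 0 & right_derivative f t l) ->
  forall t, 0 <= t <= T -> f t <= f 0.
Proof.
move=> T0 cf df.
have cf0 : f x @[x --> 0^'+] --> f 0 by have /(continuous_within_itvP _ T0)[] := cf.
have pos s t : 0 < s -> s <= t -> t <= T -> f t <= f s.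
  move=> s0 st tT; apply/ler_addgt0Pr => e e0.
  have t0 : 0 < T + 1 by lra.
  pose k := e / (T + 1); have k0 : 0 < k by rewrite divr_gt0.
  pose g x := f x - k * x.
  have cg : {within `[s, t], continuous g}.
    have sub : `[s, t]%classic `<=` `[0, T]%classic.
      by move=> x /=; rewrite !in_itv/= => /andP[]; lra.
    move=> x; apply: cvgB; first exact: (continuous_subspaceW sub cf).
    apply: cvgM; first exact: cvg_cst.
    by apply: continuous_subspaceT => y; exact: cvg_id.
  have [c cst cmin] := EVT_min st cg.
  move: (cst); rewrite in_itv/= => /andP[sc]; rewrite le_eqVlt => /predU1P[ct|ct].
    have := cmin s; rewrite in_itv/= lexx st => /(_ isT).
    rewrite ct /g => gts.
    have : k * (t - s) <= e.
      rewrite /k -mulrA ler_piMr ?(ltW e0)// mulrC ler_pdivrMr//; lra.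
    lra.
  exfalso.
  have [|l l0 dl] := df c; first by lra.
  have /cvgr_lt/(_ _ (le_lt_trans l0 k0)) near_lt := dl.
  near (0 : R)^'+ => h.
  have h0 : 0 < h by near: h; exact: nbhs_right_gt.
  have hct : h < t - c by near: h; apply: nbhs_right_lt; rewrite subr_gt0.
  have : h^-1 *: (f (c + h) - f c) < k by near: h; exact: near_lt.
  rewrite /GRing.scale/= ltr_pdivrMl// => flt.
  have := cmin (c + h); rewrite in_itv/= /g => /(_ _); lra.
move=> t /andP[]; rewrite le_eqVlt => /predU1P[<-//|t0 tT].
apply: (cvgr_to_ge cf0); near=> s; apply: pos => //.
by near: s; exact: nbhs_right_le.
Unshelve. all: by end_near. Qed.

Section flow_wellposed.
Context (R : realType) (H : completeNormedModType R) (ip : H -> H -> R).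
Hypothesis hip : inner_product ip.
Context (A : H -> set H).
Hypothesis mA : monotone_graph ip A.
Notation A0 := (min_section A).
Notation S := (flow A).

Definition solves_inclusion (T : R) (u : R -> H) :=
  {within `[0, T], continuous u} /\
  forall t, 0 < t < T -> exists du eta,
    [/\ right_derivative u t du, A (u t) eta & du + eta = 0].

(** By monotonicity the squared distance of two solutions has a nonpositive
    right derivative. *)
Lemma solution_unique T u v : 0 < T -> solves_inclusion T u ->
  solves_inclusion T v -> u 0 = v 0 -> forall t, 0 <= t <= T -> u t = v t.
Proof.
move=> T0 [cu du] [cv dv] uv0 t tT.
pose f t := `|u t - v t| ^+ 2.
have cf : {within `[0, T], continuous f}.
  have cn : {within `[0, T], continuous (fun t => `|u t - v t|)}.
    by move=> x; apply: cvg_norm; apply: cvgB; [exact: cu|exact: cv].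
  by move=> x; apply: cvgM; exact: cn.
suff df : forall t, 0 < t < T -> exists2 l, l <= 0 & right_derivative f t l.
  have := right_derivative_le0_nonincreasing T0 cf df tT.
  rewrite /f uv0 subrr normr0 expr0n/= => ft.
  apply/subr0_eq/eqP; rewrite -normr_eq0 -sqrf_eq0 eq_le.
  by rewrite ft exprn_ge0.
move=> s sT; have [du' [eta [dus Aeta deta]]] := du s sT.
have [dv' [zeta [dvs Azeta dzeta]]] := dv s sT.
exists (2 * ip (u s - v s) (du' - dv')).
  have := mA Aeta Azeta.
  have -> : du' = - eta by apply/eqP; rewrite -addr_eq0 deta.
  have -> : dv' = - zeta by apply/eqP; rewrite -addr_eq0 dzeta.
  by rewrite (ipC hip) !(ipE hip); lra.
pose q h := h^-1 *: (u (s + h) - u s) - h^-1 *: (v (s + h) - v s).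
have cq : q h @[h --> 0^'+] --> du' - dv' by exact: cvgB dus dvs.
have c1 : 2 * ip (u s - v s) (q h) + h * `|q h| ^+ 2 @[h --> 0^'+] -->
    2 * ip (u s - v s) (du' - dv') + 0 * `|du' - dv'| ^+ 2.
  apply: cvgD.
    by apply: cvgM; [exact: cvg_cst|apply: (cvg_ip hip) => //; exact: cvg_cst].
  apply: cvgM; first exact: cvg_at_right_filter cvg_id.
  have cn : `|q h| @[h --> 0^'+] --> `|du' - dv'| by exact: cvg_norm cq.
  exact: (cvgM cn cn).
rewrite mul0r addr0 in c1; apply: cvg_trans c1; apply: near_eq_cvg.
near=> h.
have h0 : h != 0 by rewrite gt_eqF//; near: h; exact: nbhs_right_gt.
rewrite /f.
have -> : u (s + h) - v (s + h) = (u s - v s) + h *: q h.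
  rewrite /q -scalerBr scalerA mulfV// scale1r.
  by apply: (eq_ip hip) => z; rewrite !(ipE hip); ring.
rewrite (sqr_normD hip (u s - v s)) normrZ exprMn real_normK ?num_real//.
rewrite (ipZr hip) -[RHS]/(h^-1 * _).
by move: (ip _ _) (`|_| ^+ 2) (`|_| ^+ 2) => a b c; field; exact: h0.
Unshelve. all: by end_near. Qed.

Hypothesis rA : full_range A.
Hypothesis dense_domain : forall x e, 0 < e ->
  exists y eta, A y eta /\ `|x - y| < e.

(** The trajectory is Lipschitz from time a on, with derivative - A0 (S t x)
    outside the jumps of its speed. *)
Lemma flow_W1infty x xi a b : 0 <= a -> A (S a x) xi -> W1infty a b (S ^~ x).
Proof.
move=> a0 Ax.
have reg := flow_regular hip mA rA dense_domain Ax.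
have rc t : a < t -> A0 (S s x) @[s --> t^'+] --> A0 (S t x).
  move=> at_; have [|At _] := reg t; first by rewrite a0 ltW.
  by apply: (min_section_right_continuous hip mA rA dense_domain At); lra.
have [||Z [cZ lc]] := @nonincreasing_left_continuous R (fun t => `|A0 (S t x)|) a b.
- move=> s t as_ st.
  have [|As _] := reg s; first by rewrite a0.
  by have [] := flow_regular hip mA rA dense_domain As (_ : 0 <= s <= t);
    rewrite ?st ?andbT ?(le_trans a0).
- by move=> t at_; exact: cvg_norm (rc t at_).
apply: (@W1infty_intro _ _ _ _ _ (fun t => - A0 (S t x)) `|A0 (S a x)| Z) => //.
- move=> s t /andP[as_ _] /andP[at_ _].
  have [A00 _] := min_sectionP hip mA rA Ax.
  have Sa r : a <= r -> S r x = S (r - a) (S a x).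
    move=> ar; rewrite -(flow_semigroup hip mA rA dense_domain) ?subr_ge0//.
    by rewrite addrC subrK.
  rewrite (Sa s as_) (Sa t at_).
  have := flow_lipschitz hip mA rA dense_domain (s - a) (t - a) A00.
  by rewrite opprB addrA subrK.
- move=> t /andP[at_ _]; rewrite normrN.
  by have [] := reg t; first by rewrite a0 ltW.
- by move=> t /andP[at_ _]; apply: cvgN; exact: rc.
- move=> t atb Zt; have /andP[at_ tb] := atb.
  apply: (flow_derivative hip mA rA dense_domain _ Ax); first by rewrite a0.
  exact: lc.
Qed.

End flow_wellposed.

(** * The maximizers of a convex set *)

Section support_operator.
Context (R : realType) (H : completeNormedModType R) (ip : H -> H -> R).
Hypothesis hip : inner_product ip.
Context (C : set H).
Implicit Types (x y eta g : H).

(** The subdifferential at x of the support function of C. *)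
Definition maximizers x : set H :=
  [set eta | C eta /\ forall g, C g -> ip g x <= ip eta x].

Lemma maximizers_monotone : monotone_graph ip maximizers.
Proof.
move=> x y xi eta [Cxi mx] [Ceta my].
by have := mx _ Ceta; have := my _ Cxi; rewrite !(ipE hip); lra.
Qed.

Lemma maximizers_homogeneous c x eta :
  0 < c -> maximizers x eta -> maximizers (c *: x) eta.
Proof.
move=> c0 [Ce mx]; split => // g Cg.
by rewrite !(ipZr hip) ler_pM2l//; exact: mx.
Qed.

Hypothesis C0 : C 0.

Lemma maximizers0 : maximizers 0 0.
Proof. by split => // g _; rewrite !(ip0r hip). Qed.

Hypothesis clC : closed C.
Hypothesis cvC : convex_subset C.

(** Moreau's decomposition: the resolvent subtracts from x the multiple of
    the projection of x / h onto C. *)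
Lemma maximizers_full_range : full_range maximizers.
Proof.
move=> h x h0.
have [p [Cp pP]] := projection_exists hip (ex_intro _ _ C0) clC cvC (h^-1 *: x).
exists (x - h *: p).
have -> : h^-1 *: (x - (x - h *: p)) = p.
  by rewrite opprB addrC subrK scalerA mulVf ?gt_eqF// scale1r.
split => // g Cg; have := pP g Cg.
have -> : h^-1 *: x - p = h^-1 *: (x - h *: p).
  by rewrite scalerBr scalerA mulVf ?gt_eqF// scale1r.
rewrite (ipZl hip) pmulr_rle0 ?invr_gt0//.
by rewrite (ipBr hip) subr_le0 (ipC hip _ g) (ipC hip _ p).
Qed.

(** If the support function of C is finite at y, then h * |Y h y|^2 stays
    bounded, so that the resolvents of y tend to y. *)
Lemma maximizers_dense :
  (forall x e, 0 < e ->
     exists y m, (forall g, C g -> ip g y <= m) /\ `|x - y| < e) ->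
  forall x e, 0 < e -> exists y eta, maximizers y eta /\ `|x - y| < e.
Proof.
move=> dn x e e0; have e20 : 0 < e / 2 by lra.
have [y [m [ym xy]]] := dn x _ e20.
have m0 : 0 <= m by have := ym _ C0; rewrite (ip0l hip).
(* the distance from y to its resolvent will satisfy |y - w| ^ 2 <= h * m *)
pose h := (e / 2) ^+ 2 / (m + 1) / 2.
have m1 : 0 < m + 1 by lra.
have h0 : 0 < h by rewrite !divr_gt0 ?exprn_gt0.
pose w := resolvent maximizers h y; pose eta := yosida maximizers h y.
have [Ceta Aeta] : maximizers w eta by exact: (yosida_in maximizers_full_range y h0).
exists w, eta; split => //.
have yw : y - w = h *: eta.
  by rewrite [X in X - _](resolventE maximizers y h0) addrC addKr.
rewrite -(subrK y x) -addrA (le_lt_trans (ler_normD _ _))//.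
rewrite [e]splitr ltrD//.
rewrite -(@ltr_pXn2r _ 2) ?nnegrE ?(ltW e20)//.
have : ip 0 w <= ip eta w by exact: Aeta.
have -> : w = y - h *: eta by rewrite -yw opprB addrC subrK.
rewrite (ip0l hip) (ipBr hip) (ipZr hip) (ipxx hip) => le0.
have := ym _ Ceta => le1.
rewrite opprB addrC subrK normrZ exprMn gtr0_norm//.
have le2 : h * (h * `|eta| ^+ 2) <= h * m by rewrite ler_wpM2l ?(ltW h0)//; lra.
have le3 : h * (m + 1) = (e / 2) ^+ 2 / 2 by rewrite /h; field; rewrite gt_eqF.
have e22 : 0 < (e / 2) ^+ 2 by rewrite exprn_gt0.
lra.
Qed.

End support_operator.

(** * The Hilbert space L^2 *)

Section L2_hilbert.
Context d (T : measurableType d) (R : realType).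
Variable mu : {measure set T -> \bar R}.
Notation Lfun2 := (LfunType mu (lee1n 2)).
Implicit Types (f g : Lfun2) (u v : L2 mu).

Lemma Lfun2_measurable f : measurable_fun setT f.
Proof. exact: measurable_funPT. Qed.

Lemma Lfun2_integrable_mul f g : mu.-integrable setT (EFin \o (fun x => f x * g x)).
Proof. exact/Lfun1_integrable/(Lfun2_mul_Lfun1 (LfunP f) (LfunP g)). Qed.

Lemma ae_eq_Rintegral (f g : T -> R) : measurable_fun setT f ->
  measurable_fun setT g -> (\forall x \ae mu, f x = g x) ->
  (\int[mu]_x f x = \int[mu]_x g x)%R.
Proof.
move=> mf mg fg; congr fine; apply: ae_eq_integral => //.
- exact/measurable_EFinP.
- exact/measurable_EFinP.
- by apply: filterS fg => x /= ->.
Qed.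

Lemma L2_innerE f g : L2_inner (L2class f) (L2class g) = (\int[mu]_x (f x * g x))%R.
Proof.
apply: ae_eq_Rintegral.
- by apply: measurable_funM; exact: Lfun2_measurable.
- by apply: measurable_funM; exact: Lfun2_measurable.
- by apply: filterS2 (L2classK f) (L2classK g) => x -> ->.
Qed.

Lemma L2class_scale a f : a *: L2class f = L2class (a *: f).
Proof. exact: L2_scale_class. Qed.

Lemma L2class_opp f : - L2class f = L2class (- f).
Proof. by rewrite -scaleN1r L2class_scale scaleN1r. Qed.

Lemma L2_sqr_norm f : (`|L2class f| ^+ 2)%:E = (\int[mu]_x (f x ^+ 2)%:E)%E.
Proof.
rewrite [`|_|]L2_norm_class.
have -> : ((fine 'N[mu]_2[EFin \o f]%E) ^+ 2)%:E = ('N[mu]_2[EFin \o f] `^ 2)%E.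
  rewrite -[in RHS](finite_norm_fine f) poweR_EFin powR_mulrn//.
  by rewrite fine_ge0// Lnorm_ge0.
rewrite poweR_Lnorm//; apply: eq_integral => x _ /=.
by rewrite powR_mulrn// real_normK ?num_real.
Qed.

Lemma L2_inner_product : inner_product (@L2_inner d T R mu).
Proof.
split.
- by move=> u v; apply: eq_Rintegral => x _; rewrite mulrC.
- move=> u v w; rewrite -(L2funK u) -(L2funK v) -(L2funK w) -L2classD !L2_innerE.
  rewrite -RintegralD//; try exact: Lfun2_integrable_mul.
  by apply: eq_Rintegral => x _; rewrite -mulrDl.
- move=> a u v; rewrite -(L2funK u) -(L2funK v) L2class_scale !L2_innerE.
  rewrite -RintegralZl//; last exact: Lfun2_integrable_mul.
  by apply: eq_Rintegral => x _; rewrite mulrA.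
- move=> u; rewrite -(L2funK u) L2_innerE.
  by rewrite -[RHS]/(fine (_%:E)) L2_sqr_norm; apply: eq_Rintegral.
Qed.

Lemma Lfun2P (f : T -> R) : measurable_fun setT f ->
  (\int[mu]_x (f x ^+ 2)%:E < +oo)%E -> f \in Lfun mu 2%:E.
Proof.
move=> mf fi; rewrite inE; apply/andP; split; rewrite inE//=.
rewrite /finite_norm unlock poweR_lty//.
rewrite (_ : (fun _ => _) = (fun x => (f x ^+ 2)%:E))//.
by apply/funext => x /=; rewrite powR_mulrn// real_normK ?num_real.
Qed.

(** Riesz-Fischer for a fast Cauchy sequence: the increments d_k satisfy
    sum_k 4 ^ k * |d_k| ^ 2 < oo almost everywhere, hence decay geometrically
    there, so the functions converge pointwise; Fatou's lemma identifies the
    limit in norm. *)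
Lemma L2_fast_cauchy_cvg (u : nat -> L2 mu) :
  (forall n m, (n <= m)%N -> `|u m - u n| ^+ 2 <= (2 * 8 ^+ n)^-1) ->
  exists v, forall n, `|v - u n| ^+ 2 <= (2 * 8 ^+ n)^-1.
Proof.
move=> uC.
pose f n : Lfun2 := L2fun (u n).
have fE n : u n = L2class (f n) by rewrite L2funK.
have mf n : measurable_fun setT (f n) by exact: Lfun2_measurable.
have mB n m : measurable_fun setT (fun x => (f m x - f n x) ^+ 2).
  by apply: measurable_funX; apply: measurable_funB.
have iB n m : (n <= m)%N ->
    (\int[mu]_x ((f m x - f n x) ^+ 2)%:E <= ((2 * 8 ^+ n)^-1)%:E)%E.
  move=> nm; have := uC n m nm.
  by rewrite -lee_fin !fE L2class_opp -L2classD L2_sqr_norm.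
pose h x := (\sum_(k <oo) (4 ^+ k * (f k.+1 x - f k x) ^+ 2)%:E)%E.
have h0 k x : (0 <= (4 ^+ k * (f k.+1 x - f k x) ^+ 2)%:E)%E.
  by rewrite lee_fin mulr_ge0 ?sqr_ge0// exprn_ge0.
have mhk k : measurable_fun setT (fun x => (4 ^+ k * (f k.+1 x - f k x) ^+ 2)%:E).
  by apply/measurable_EFinP; apply: measurable_funM.
have mh : measurable_fun setT h.
  by apply: (ge0_emeasurable_sum (P := xpredT)).
have hge0 x : (0 <= h x)%E by exact: nneseries_ge0.
have ih : (\int[mu]_x h x <= 1)%E.
  rewrite integral_nneseries//.
  apply: (@le_trans _ _ (\sum_(k <oo) (1 / (2 ^ k.+1)%:R)%:E)%E); last first.
    exact: (epsilon_trick0 xpredT).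
  apply: lee_nneseries => [k _ _|k _]; first by apply: integral_ge0 => x _.
  under eq_integral do rewrite EFinM.
  rewrite ge0_integralZl//; last 2 first.
  - exact/measurable_EFinP.
  - by move=> x _; rewrite lee_fin sqr_ge0.
  (* 4 ^ k / (2 * 8 ^ k) = 1 / 2 ^ (k + 1), and these sum up to 1 *)
  apply: (@le_trans _ _ ((4 ^+ k)%:E * ((2 * 8 ^+ k)^-1)%:E)%E).
    by rewrite lee_wpmul2l ?lee_fin ?exprn_ge0// iB.
  rewrite -EFinM lee_fin natrX exprS le_eqVlt; apply/orP; left; apply/eqP.
  have -> : (8 : R) = 4 * 2 by rewrite -natrM.
  by rewrite exprMn; field; rewrite !expf_neq0.
have hfin : \forall x \ae mu, h x \is a fin_num.
  have hi : mu.-integrable setT h.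
    apply/integrableP; split => //.
    under eq_integral do rewrite gee0_abs//.
    by rewrite (le_lt_trans ih)// ltry.
  by apply: filterS (integrable_ae measurableT hi) => x; apply.
pose E := [set x | h x \is a fin_num].
have mE : measurable E.
  rewrite (_ : E = [set x | h x \is a fin_num]).
    by rewrite -[X in measurable X]setTI; exact: emeasurable_fin_num.
  by [].
have fcvg x : E x -> cvgn (fun n => f n x).
  move=> Ex.
  pose M := fine (h x).
  have M0 : 0 <= M by exact: fine_ge0.
  have dM k : `|f k.+1 x - f k x| <= geometric (Num.sqrt M) 2^-1 k.
    rewrite /geometric /= -(@ler_pXn2r _ 2) ?nnegrE ?mulr_ge0 ?sqrtr_ge0 ?exprn_ge0//.
    rewrite exprMn sqr_sqrtr// real_normK ?num_real//.
    rewrite -exprM mulnC exprM -(@ler_pM2l _ (4 ^+ k)) ?exprn_gt0//.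
    have -> : 4 ^+ k * (M * (2^-1 ^+ 2) ^+ k) = M.
      rewrite mulrCA -exprMn.
      have -> : 4 * 2^-1 ^+ 2 = 1 :> R by field.
      by rewrite expr1n mulr1.
    rewrite -lee_fin /M fineK//.
    have := nneseries_lim_ge k.+1 (fun i _ _ => h0 i x) (P := xpredT) (m := 0%N).
    apply: le_trans; rewrite big_nat_recr//= leeDr//.
    by apply: sume_ge0 => i _.
  have : cvgn (series (telescope (fun n => f n x))).
    apply: normed_cvg; apply: series_le_cvg dM _ => //.
    - by move=> k; rewrite /geometric/= mulr_ge0 ?sqrtr_ge0 ?exprn_ge0.
    - by apply: is_cvg_geometric_series; rewrite ger0_norm ?invr_ge0// invf_lt1// ltr1n.
  rewrite telescopeK => /cvg_ex[l fl]; apply/cvg_ex; exists (l + f 0 x).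
  rewrite (_ : (fun n => f n x) = (fun n => (f n x - f 0 x) + f 0 x)).
    by apply: cvgD; [exact: fl|exact: cvg_cst].
  by apply/funext => n; rewrite subrK.
pose fe n x := f n x * \1_E x.
have mfe n : measurable_fun setT (fe n).
  by apply: measurable_funM.
have fe_le n m x : (fe m x - fe n x) ^+ 2 <= (f m x - f n x) ^+ 2.
  rewrite /fe -mulrBl exprMn indicE; case: (x \in E); rewrite ?expr1n ?mulr1//.
  by rewrite expr0n mulr0 sqr_ge0.
pose g x := limn (fun n => fe n x).
have feg x : fe n x @[n --> \oo] --> g x.
  apply: (_ : cvgn (fun n => fe n x)); rewrite /fe indicE.
  have [xE|xE] := boolP (x \in E); last first.
    by under eq_fun do rewrite mulr0; exact: is_cvg_cst.
  by under eq_fun do rewrite mulr1; apply: fcvg; exact: set_mem.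
have mg : measurable_fun setT g.
  by apply: (measurable_fun_cvg (h := fe)) => // x _; exact: feg.
have ig n : (\int[mu]_x ((g x - fe n x) ^+ 2)%:E <= ((2 * 8 ^+ n)^-1)%:E)%E.
  pose F m x := ((fe (m + n)%N x - fe n x) ^+ 2)%:E.
  have Fl x : limn_einf (F ^~ x) = ((g x - fe n x) ^+ 2)%:E.
    have c : F m x @[m --> \oo] --> ((g x - fe n x) ^+ 2)%:E.
      apply: cvg_EFin; first exact: nearW.
      have c1 : fe (m + n)%N x - fe n x @[m --> \oo] --> g x - fe n x.
        apply: cvgB; last exact: cvg_cst.
        by rewrite (cvg_shiftn n (fun m => fe m x)).
      exact: (cvgM c1 c1).
    by rewrite (cvg_limn_einf_sup c).1.
  under eq_integral do rewrite -Fl.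
  apply: le_trans (fatou _ _ _ _) _ => //.
  - move=> m; apply/measurable_EFinP; apply: measurable_funX.
    exact: measurable_funB.
  - by move=> m x _; rewrite lee_fin sqr_ge0.
  rewrite limn_einf_lim; apply: lime_le; first exact: is_cvg_einfs.
  apply: nearW => k; apply: ge_ereal_inf.
  exists (\int[mu]_x F k x)%E; first by exists k => /=.
  apply: le_trans (iB n (k + n)%N (leq_addl _ _)).
  apply: ge0_le_integral => //.
  - by move=> x _; rewrite lee_fin sqr_ge0.
  - apply/measurable_EFinP; apply: measurable_funX.
    exact: measurable_funB.
  - exact/measurable_EFinP.
  - by move=> x _; rewrite lee_fin; exact: fe_le.
have fef n : \forall x \ae mu, f n x = fe n x.
  by apply: filterS hfin => x xE; rewrite /fe indicE mem_set ?mulr1.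
have mgf n : measurable_fun setT (fun x => g x - f n x) by exact: measurable_funB.
have igf n : (\int[mu]_x ((g x - f n x) ^+ 2)%:E <= ((2 * 8 ^+ n)^-1)%:E)%E.
  apply: le_trans (ig n); rewrite le_eqVlt; apply/orP; left; apply/eqP.
  apply: ae_eq_integral => //.
  - by apply/measurable_EFinP; exact: measurable_funX.
  - by apply/measurable_EFinP; apply: measurable_funX; exact: measurable_funB.
  - by apply: filterS (fef n) => x /= <-.
have gfP n : (fun x => g x - f n x) \in Lfun mu 2%:E.
  by apply: Lfun2P => //; rewrite (le_lt_trans (igf n))// ltry.
pose w : Lfun2 := Lfun_Sub (lee1n 2) (gfP 0%N).
exists (L2class (w + f 0%N)) => n.
rewrite fE L2class_opp -L2classD -lee_fin L2_sqr_norm.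
apply: le_trans (igf n); rewrite le_eqVlt; apply/orP; left; apply/eqP.
apply: eq_integral => x _.
by rewrite -[(w + _ - _) x]/(g x - f 0%N x + f 0%N x - f n x) subrK.
Qed.

Lemma L2_complete (F : set_system (L2 mu)) : ProperFilter F -> cauchy F -> cvg F.
Proof.
move=> FF /cauchyP Fc.
(* chosen for (2 * r n) ^ 2 to be below the modulus 1 / (2 * 8 ^ n): the centres
   of two balls of the filter of radius at most r n are at distance < 2 * r n *)
pose r n : R := (4 * 4 ^+ n)^-1.
have r0 n : 0 < r n by rewrite invr_gt0 mulr_gt0 ?exprn_gt0.
pose x n := projT1 (cid (Fc _ (r0 n))).
have xP n : F (ball (x n) (r n)) by rewrite /x; case: cid.
have rle n m : (n <= m)%N -> r m <= r n.
  move=> nm; rewrite lef_pV2 ?posrE ?mulr_gt0 ?exprn_gt0//.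
  by rewrite ler_pM2l// ler_weXn2l// ler1n.
have r2 n : (2 * r n) ^+ 2 <= (2 * 8 ^+ n)^-1.
  have -> : (2 * r n) ^+ 2 = (4 * 16 ^+ n)^-1.
    rewrite /r; have -> : (16 : R) = 4 * 4 by rewrite -natrM.
    by rewrite [in RHS]exprMn; field; rewrite expf_neq0.
  rewrite lef_pV2 ?posrE ?mulr_gt0 ?exprn_gt0//.
  by rewrite ler_pM ?exprn_ge0 ?lerXn2r ?nnegrE ?ler_nat.
have [v vP] : exists v, forall n, `|v - x n| ^+ 2 <= (2 * 8 ^+ n)^-1.
  apply: L2_fast_cauchy_cvg => n m nm; apply: le_trans (r2 n).
  rewrite ler_pXn2r ?nnegrE ?mulr_ge0 ?(ltW (r0 n))//.
  have [y [yn ym]] := filter_ex (filterI (xP n) (xP m)).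
  rewrite -ball_normE/= in yn; rewrite -ball_normE/= in ym.
  rewrite -(subrK y (x m)) -addrA (le_trans (ler_normD _ _))// mulrDl mul1r.
  by rewrite lerD ?(le_trans (ltW ym))// ?rle// distrC ltW.
apply/cvg_ex; exists v; apply/cvg_ballP => e e0.
have e2 : 0 < Num.min ((e / 2) ^+ 2) (e / 2).
  by rewrite lt_min exprn_gt0 divr_gt0.
have [n _ /(_ n (leqnn _)) /= ne] := near_infty_natSinv_lt (PosNum e2).
rewrite lt_min /= in ne; case/andP: ne => n1 n2.
have n8 : n.+1%:R <= 2 * 8 ^+ n :> R.
  apply: (@le_trans _ _ (8 ^+ n)); last by rewrite ler_peMl ?exprn_ge0 ?ler1n.
  by rewrite -natrX ler_nat ltn_expl.
have n4 : n.+1%:R <= 4 * 4 ^+ n :> R.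
  apply: (@le_trans _ _ (4 ^+ n)); last by rewrite ler_peMl ?exprn_ge0 ?ler1n.
  by rewrite -natrX ler_nat ltn_expl.
near=> y.
have : ball (x n) (r n) y by near: y; exact: xP.
rewrite -!ball_normE /= => xy.
rewrite -(subrK (x n) v) -addrA (le_lt_trans (ler_normD _ _))// [e]splitr ltrD//.
  rewrite -(@ltr_pXn2r _ 2) ?nnegrE ?divr_ge0 ?(ltW e0)//.
  apply: le_lt_trans (vP n) _; apply: le_lt_trans n1.
  by rewrite lef_pV2 ?posrE ?mulr_gt0 ?exprn_gt0.
apply: lt_trans xy _; apply: le_lt_trans n2.
by rewrite lef_pV2 ?posrE ?mulr_gt0 ?exprn_gt0.
Unshelve. all: by end_near. Qed.

HB.instance Definition _ := Uniform_isComplete.Build (L2 mu) L2_complete.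

End L2_hilbert.

(** * Translation invariance of Lebesgue measure *)

Section lebesgue_translation.
Context (R : realType) (d : nat).
Notation lambda := (lebesgue_rV R d).
Implicit Types (a b x : 'rV[R]_d).

Definition open_box a b := [set x : 'rV[R]_d | forall i, a 0 i < x 0 i < b 0 i].

Lemma open_box_open a b : open (open_box a b).
Proof.
rewrite (_ : open_box a b = [set x : 'rV[R]_d | forall i,
    ((fun y : 'rV[R]_d => y 0 i) @^-1` `]a 0 i, b 0 i[) x]); last first.
  by apply/seteqP; split => x h i; have := h i; rewrite /= in_itv.
rewrite openE => x hx; rewrite /interior.
apply/(filter_forall (F := nbhs x)) => i.
apply: open_nbhs_nbhs; split; last exact: hx.
apply: (@open_comp _ _ (fun y : 'rV[R]_d => y 0 i)) => [y _|].
  exact: coord_continuous.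
exact: interval_open.
Qed.

Lemma open_box_cube_lty (M : R) : (lambda (open_box (const_mx (- M)%R) (const_mx M)) < +oo)%E.
Proof.
rewrite lebesgue_rV_box.
rewrite ltey_eq; apply/orP; left; apply: prode_fin_num => i _.
by rewrite lebesgue_measure_itv/=; case: ifP.
Qed.

Lemma bounded_sub_cube (A : set 'rV[R]_d) : bounded_set A ->
  exists2 M, 0 < M & A `<=` open_box (const_mx (- M)) (const_mx M).
Proof.
move=> [M [_ AM]]; exists (`|M| + 2); first by rewrite ltr_wpDl.
move=> x /AM; have MM : M < `|M| + 1 by rewrite (le_lt_trans (ler_norm M))// ltrDl.
move=> /(_ _ MM) xM i; rewrite !mxE -ltr_norml.
have : `|x 0 i| <= `|x|.
  rewrite [`|x|]mx_normrE; exact: (le_bigmax _ (fun ij => `|x ij.1 ij.2|) (0, i)).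
by move=> /le_trans/(_ xM) h; rewrite (le_lt_trans h)// ltrD2l ltr1n.
Qed.

Lemma measurable_translation a :
  measurable_fun setT (fun x : borel_rV R d => (x + a : borel_rV R d)).
Proof.
apply: (@measurability _ _ _ (borel_rV R d) setT
  (fun x : borel_rV R d => x + a : borel_rV R d) (@open 'rV[R]_d)) => //.
move=> _ [U oU <-]; rewrite setTI; apply: open_rV_measurable.
have c : continuous (fun x : 'rV[R]_d => x + a).
  by move=> x; exact: (cvgD cvg_id (cvg_cst a)).
by apply: open_comp => // x _; exact: c.
Qed.

Lemma ball_open_box a (r : R) : 0 < r ->
  ball a r = open_box (a - const_mx r) (a + const_mx r).
Proof.
move=> r0; apply/seteqP; split => x.
  move=> /(ball_rVE _ _ r0) h i; have := h i.
  by rewrite !mxE distrC ltr_distl.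
by move=> h; apply/ball_rVE => // i; have := h i; rewrite !mxE distrC ltr_distl.
Qed.

Definition open_boxes :=
  [set B | exists p : 'rV[R]_d * 'rV[R]_d, B = open_box p.1 p.2].

Lemma sigma_open_boxes : <<s @open 'rV[R]_d >> = <<s open_boxes >>.
Proof.
apply/seteqP; split; apply: smallest_sub; try exact: smallest_sigma_algebra.
  move=> U oU; rewrite (open_rV_bigcup oU) bigcup_mkcond.
  apply: (@countable_bigcupT_measurable _ (g_sigma_algebraType open_boxes));
    first exact: countableP.
  move=> q; case: ifPn => [/set_mem[q0 _]|_]; last exact: measurable0.
  apply: sub_sigma_algebra; rewrite ball_open_box ?ltr0q//.
  by eexists (_, _).
move=> _ [p ->]; apply: sub_sigma_algebra; exact: open_box_open.
Qed.

Lemma open_boxes_setI : setI_closed open_boxes.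
Proof.
move=> B1 B2 [[a1 b1] ->] [[a2 b2] ->].
exists (\row_i Num.max (a1 0 i) (a2 0 i), \row_i Num.min (b1 0 i) (b2 0 i)).
apply/seteqP; split => x /=.
  move=> [h1 h2] i; rewrite !mxE gt_max lt_min.
  by have /andP[p1 p2] := h1 i; have /andP[p3 p4] := h2 i; apply/andP; split; apply/andP.
by move=> h; split => i; have := h i; rewrite !mxE gt_max lt_min;
  move=> /andP[/andP[p1 p2] /andP[p3 p4]]; apply/andP.
Qed.

Lemma bigcup_cubes :
  \bigcup_n (open_box (const_mx (- n%:R)) (const_mx n%:R)) = [set: 'rV[R]_d].
Proof.
apply/seteqP; split => // x _; exists (Num.truncn (`|x|)).+1 => //= i.
rewrite !mxE -ltr_norml; apply: le_lt_trans (truncnS_gt _).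
rewrite [leRHS]mx_normrE; exact: (le_bigmax _ (fun ij => `|x ij.1 ij.2|) (0, i)).
Qed.

(** The measure of a box depends only on the lengths of its sides, and the
    boxes are stable under intersection and generate the Borel sets. *)
Lemma lebesgue_rV_translation a A : measurable (A : set (borel_rV R d)) ->
  lambda ((fun x => x + a) @^-1` A) = lambda A.
Proof.
move=> mA.
have mt := measurable_translation a.
(* m2 stands for the image of lambda, whose structure of measure depends on the
   proof mt and is supplied at the end *)
have m2E : forall m2 : {measure set (borel_rV R d) -> \bar R},
  (forall B, m2 B = lambda ((fun x => x + a) @^-1` B)) -> m2 A = lambda A.
  move=> m2 m2E; pose g (n : nat) := open_box (const_mx (- n%:R)) (const_mx n%:R).
  have box_eq p : m2 (open_box p.1 p.2) = lambda (open_box p.1 p.2).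
    rewrite m2E (_ : _ @^-1` _ = open_box (p.1 - a) (p.2 - a)).
      rewrite !lebesgue_rV_box; apply: eq_bigr => i _.
      rewrite !lebesgue_measure_itv/= !mxE !lte_fin ltrD2r; case: ifP => // _.
      by rewrite -!EFinB; congr EFin; ring.
    by apply/seteqP; split => x h i; have := h i; rewrite !mxE ltrBlDr ltrBrDr.
  apply: (@measure_unique _ R (borel_rV R d) open_boxes g) => //.
  - exact: sigma_open_boxes.
  - exact: open_boxes_setI.
  - by move=> n; exists (const_mx (- n%:R), const_mx n%:R).
  - exact: bigcup_cubes.
  - by move=> _ [p ->]; exact: box_eq.
  - move=> k; rewrite (box_eq (_, _)); exact: open_box_cube_lty.
pose m2 := measure_function_pushforward__canonical__measure_function_Measure lambda mt.
exact: (m2E m2).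
Qed.
End lebesgue_translation.

Section lipschitz_variation.
Context (R : realType) (d : nat).
Notation lambda := (lebesgue_rV R d).
Notation cube M := (@open_box R d (const_mx (- M)) (const_mx M)).
Implicit Types (a x y : 'rV[R]_d).

Lemma continuous_measurable_rV (g : 'rV[R]_d -> R) : continuous g ->
  measurable_fun setT (g : borel_rV R d -> R).
Proof.
move=> cg; apply: (measurability _ (RGenOInfty.measurableE R)) => // _ [_ [x ->] <-].
rewrite setTI; apply: open_rV_measurable; apply: open_comp => [y _|]; first exact: cg.
exact: interval_open.
Qed.

Lemma cube_supported_integrable (g : 'rV[R]_d -> R) M B :
  measurable_fun setT (g : borel_rV R d -> R) -> (forall x, `|g x| <= B) ->
  (forall x, ~ cube M x -> g x = 0) -> lambda.-integrable setT (EFin \o g).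
Proof.
move=> mg gB g0.
have mQ : measurable (cube M : set (borel_rV R d)).
  by apply: open_rV_measurable; exact: open_box_open.
have : lambda.-integrable (cube M) (EFin \o g).
  apply: measurable_bounded_integrable => //.
  - exact: open_box_cube_lty.
  - exact: measurable_funTS.
  - exists B; split; first exact: num_real.
    by move=> r Br x _; exact: le_trans (gB x) (ltW Br).
move/(integrable_mkcond _ mQ).1.
rewrite (_ : (EFin \o g) \_ _ = EFin \o g)//.
apply/funext => x; rewrite patchE; case: ifPn => // /negP xQ /=.
by rewrite g0// => /mem_set.
Qed.

Lemma integral_translation (g : 'rV[R]_d -> R) a :
  lambda.-integrable setT (EFin \o (fun x => g (x + a))) ->
  measurable_fun setT (g : borel_rV R d -> R) ->
  (\int[lambda]_x g (x + a))%R = (\int[lambda]_x g x)%R.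
Proof.
move=> ig mg; congr fine.
have mt := @measurable_translation R d a.
have mgE : measurable_fun setT (EFin \o g : borel_rV R d -> \bar R) by exact/measurable_EFinP.
have := @integral_pushforward _ _ (borel_rV R d) (borel_rV R d) R _ mt lambda setT (EFin \o g) mgE ig measurableT.
move=> <-; apply: eq_measure_integral => B mB _.
exact: lebesgue_rV_translation.
Qed.

Lemma coord_norm_le x i : `|x 0 i| <= `|x|.
Proof.
by rewrite [leRHS]mx_normrE; exact: (le_bigmax _ (fun ij => `|x ij.1 ij.2|) (0, i)).
Qed.

End lipschitz_variation.

(** * Test fields *)

Section test_field_theory.
Context (R : realType) (d : nat) (Omega : set 'rV[R]_d).
Variable psi : 'rV[R]_d -> 'rV[R]_d.
Hypothesis tpsi : test_field Omega psi.
Notation e i := (delta_mx 0 i : 'rV[R]_d).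
Notation D i x := ('D_(e i) psi x 0 i).
Implicit Types (x : 'rV[R]_d) (i : 'I_d).

Lemma test_field_continuous : continuous psi.
Proof. by have [sm _ _] := tpsi; have [] := sm 0%N. Qed.

Lemma test_field_derivable v x : derivable psi x v.
Proof. by have [sm _ _] := tpsi; have [_ /(_ v)[h _]] := sm 1%N; exact: h. Qed.

Lemma test_field_derive_continuous v : continuous (fun x => 'D_v psi x).
Proof. by have [sm _ _] := tpsi; have [_ /(_ v)[_ []]] := sm 1%N. Qed.

Lemma partial_continuous i : continuous (fun x => D i x).
Proof.
move=> x; apply: (@continuous_comp _ _ _ (fun x => 'D_(e i) psi x) (fun y : 'rV[R]_d => y 0 i)).
  exact: test_field_derive_continuous.
exact: coord_continuous.
Qed.

Lemma test_field_out x : ~ Omega x -> psi x = 0.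
Proof.
have [_ _ sO] := tpsi; move=> nO; apply/eqP; apply: contra_notT nO => px.
by apply: sO; exact: subset_closure.
Qed.

Lemma derive_out_support v x : ~ closure [set x | psi x != 0] x -> 'D_v psi x = 0.
Proof.
move=> nK; have -> : 'D_v psi x = 'D_v (cst 0) x.
  apply: near_eq_derive.
  have := open_nbhs_nbhs (conj (closed_openC (@closed_closure _ _)) nK).
  apply: filterS => y yK; apply/eqP; apply: contra_notT yK => py.
  exact: subset_closure.
exact: derive_cst.
Qed.

Lemma derive_out v x : ~ Omega x -> 'D_v psi x = 0.
Proof.
by have [_ _ sO] := tpsi; move=> nO; apply: derive_out_support => /sO.
Qed.

Lemma partial_bounded : exists C, forall i x, `|D i x| <= C.
Proof.
have [_ cK sO] := tpsi; set K := closure _ in cK sO.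
have bd i : exists C, forall x, `|D i x| <= C.
  have := @continuous_compact _ _ (fun x => D i x) K.
  move=> /(_ (continuous_subspaceT (@partial_continuous i)) cK)/compact_bounded[M [_ hM]].
  exists (`|M| + 1) => x.
  have [Kx|nK] := pselect (K x).
    by apply: hM; [rewrite (le_lt_trans (ler_norm M))// ltrDl|exists x].
  rewrite derive_out_support//.
  by rewrite mxE normr0 addr_ge0.
pose C i := projT1 (cid (bd i)).
exists (\sum_i `|C i|) => i x.
have Ci : `|D i x| <= C i by rewrite /C; case: cid.
rewrite (le_trans Ci)// (le_trans (ler_norm _))// (bigD1 i)//= lerDl.
exact: sumr_ge0.
Qed.

Lemma quotient_cvg i x :
  h^-1 * (psi (x + h *: e i) 0 i - psi x 0 i) @[h --> 0^'] --> D i x.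
Proof.
have dp : (h^-1 *: ((psi \o shift x) (h *: e i) - psi x)) @[h --> 0^'] --> 'D_(e i) psi x.
  exact: (@test_field_derivable (e i) x).
have := cvg_comp _ _ dp (@coord_continuous R 1 d 0 i ('D_(e i) psi x)).
rewrite (_ : _ \o _ = (fun h => h^-1 * (psi (x + h *: e i) 0 i - psi x 0 i)))//.
by apply/funext => h /=; rewrite [LHS]mxE [in LHS]mxE [in X in _ + X]mxE (addrC x).
Qed.

Lemma coord_derive i x (s : R) :
  is_derive s (1 : R) (fun s => psi (x + s *: e i) 0 i) (D i (x + s *: e i)).
Proof.
have c := @quotient_cvg i (x + s *: e i).
have E : (fun h : R => h^-1 *: (((fun s => psi (x + s *: e i) 0 i) \o shift s) (h *: (1 : R))
     - psi (x + s *: e i) 0 i)) =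
   (fun h => h^-1 * (psi (x + s *: e i + h *: e i) 0 i - psi (x + s *: e i) 0 i)).
  apply/funext => h /=; rewrite -[h *: 1]/(h * 1) mulr1 -addrA -scalerDl.
  by rewrite (addrC s).
apply: DeriveDef; first by apply/cvg_ex; exists (D i (x + s *: e i)); rewrite E.
rewrite /derive E; exact: cvg_lim c.
Qed.

Lemma quotient_bounded C i x (h : R) : (forall i x, `|D i x| <= C) -> 0 < h ->
  `|h^-1 * (psi (x + h *: e i) 0 i - psi x 0 i)| <= C.
Proof.
move=> DC h0.
have [||c _ hc] := @MVT R (fun s => psi (x + s *: e i) 0 i) (fun s => D i (x + s *: e i)) 0 h h0.
- by move=> s _; exact: coord_derive.
- apply: continuous_subspaceT => s.
  apply: differentiable_continuous; apply/derivable1_diffP.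
  by have [] := @coord_derive i x s.
rewrite scale0r addr0 subr0 in hc.
by rewrite hc mulrCA mulVf ?gt_eqF// mulr1.
Qed.

Lemma coord_le1 : (forall x, euclidean_norm (psi x) <= 1) -> forall i x, `|psi x 0 i| <= 1.
Proof.
move=> p1 i x; apply: le_trans (p1 x).
rewrite -sqrtr_sqr ler_sqrt; last by apply: sumr_ge0 => j _; exact: sqr_ge0.
by rewrite (bigD1 i)//= lerDl; apply: sumr_ge0 => j _; exact: sqr_ge0.
Qed.

End test_field_theory.

(** * The total variation of a Lipschitz function *)

Section lipschitz_total_variation.
Context (R : realType) (d : nat).
Notation lambda := (lebesgue_rV R d).
Notation cube M := (@open_box R d (const_mx (- M)) (const_mx M)).
Notation e i := (delta_mx 0 i : 'rV[R]_d).
Context (f : 'rV[R]_d -> R) (K B : R).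
Hypothesis fB : forall x, `|f x| <= B.
Hypothesis fK : forall x y, `|f x - f y| <= K * `|x - y|.
Context (Omega : set 'rV[R]_d) (M : R).
Hypothesis OM : Omega `<=` cube M.

Lemma lipschitz_continuous : continuous f.
Proof.
move=> x U /nbhs_ballP[r /= r0 rU].
have K1 : 0 < `|K| + 1 by rewrite ltr_wpDl.
apply/nbhs_ballP; exists (r / (`|K| + 1)); first by rewrite /= divr_gt0.
move=> y; rewrite mx_norm_ball /ball_/= ltr_pdivlMr// => xy.
apply: rU; rewrite -ball_normE/=; apply: le_lt_trans xy.
apply: le_trans (fK x y) _; rewrite mulrC ler_wpM2l//.
by rewrite (le_trans (ler_norm K))// lerDl.
Qed.

Lemma rV_continuousM (g g' : 'rV[R]_d -> R) : continuous g -> continuous g' ->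
  continuous (fun x => g x * g' x).
Proof. by move=> c c' x; exact: (cvgM (c x) (c' x)). Qed.

Lemma rV_continuousB (g g' : 'rV[R]_d -> R) : continuous g -> continuous g' ->
  continuous (fun x => g x - g' x).
Proof. by move=> c c' x; exact: (cvgB (c x) (c' x)). Qed.

Lemma norm_delta_le i : `|e i| <= 1.
Proof.
rewrite [leLHS]mx_normrE; apply: bigmax_le => //= -[j k] _ /=.
by rewrite mxE; case: (_ && _); rewrite ?normr1 ?normr0.
Qed.

Lemma cube_sub (N N' : R) : N <= N' -> cube N `<=` cube N'.
Proof.
move=> NN x h i; have := h i; rewrite !mxE => /andP[h1 h2].
by apply/andP; split; [apply: le_lt_trans h1; rewrite lerN2|apply: lt_le_trans NN].
Qed.

Lemma measurable_cube (N : R) : measurable (cube N : set (borel_rV R d)).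
Proof. by apply: open_rV_measurable; exact: open_box_open. Qed.

Section one_field.
Variable psi : 'rV[R]_d -> 'rV[R]_d.
Hypothesis tpsi : test_field Omega psi.
Hypothesis psi1 : forall x, euclidean_norm (psi x) <= 1.
Variable i : 'I_d.
Notation D x := ('D_(e i) psi x 0 i).
Notation h := (fun n : nat => n.+1%:R^-1 : R).
Notation p x := (psi x 0 i).

Let pc : continuous (fun x => p x).
Proof.
move=> x; apply: (@continuous_comp _ _ _ psi (fun y : 'rV[R]_d => y 0 i)).
  exact: (test_field_continuous tpsi).
exact: coord_continuous.
Qed.

Let translate_continuous (g : 'rV[R]_d -> R) (a : 'rV[R]_d) : continuous g ->
  continuous (fun x : 'rV[R]_d => g (x + a)).
Proof.
move=> cg x; apply: (@continuous_comp _ _ _ (fun x : 'rV[R]_d => x + a) g).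
  exact: (cvgD cvg_id (cvg_cst a)).
exact: cg.
Qed.

Let out x : ~ cube M x -> p x = 0.
Proof. by move=> nx; rewrite (test_field_out tpsi) ?mxE// => /OM. Qed.

Let B0 : 0 <= B. Proof. exact: le_trans (fB 0). Qed.

Let K0 : 0 <= K.
Proof.
have := fK (e i) 0; rewrite subr0 => /(le_trans (normr_ge0 _)).
by rewrite pmulr_lge0// normr_gt0; apply/negP => /eqP/matrixP/(_ 0 i)/eqP;
  rewrite !mxE !eqxx/= oner_eq0.
Qed.

Let h01 n : 0 < h n <= 1.
Proof. by rewrite invr_gt0 ltr0n/= invf_le1// ler1n. Qed.

Let q n (x : 'rV[R]_d) : R := (h n)^-1 * (p (x + h n *: e i) - p x).

Let qc n : continuous (q n).
Proof.
apply: rV_continuousM; first exact: cst_continuous.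
apply: rV_continuousB; last exact: pc.
exact: (@translate_continuous (fun x => p x) (h n *: e i) pc).
Qed.

Let shift_out n x : ~ cube (M + 1) x -> p (x + h n *: e i) = 0.
Proof.
move=> nx; apply: out => xh; apply: nx => j; have := xh j; rewrite !mxE.
have := coord_norm_le (e i) j => /le_trans/(_ (norm_delta_le i)).
rewrite !mxE /= ler_norml => /andP[e1 e2] /andP[h1 h2].
have /andP[n0 n1] := h01 n.
have : h n * (j == i)%:R <= 1.
  by case: eqP => _ /=; rewrite ?mulr1 ?mulr0.
have : 0 <= h n * (j == i)%:R by rewrite mulr_ge0 ?ler0n ?(ltW n0).
by move: h1 h2; move: (n.+1%:R^-1 * _) => t; lra.
Qed.

Let q_out n x : ~ cube (M + 1) x -> q n x = 0.
Proof.
move=> nx; rewrite /q shift_out// out ?subrr ?mulr0//.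
by move=> /(@cube_sub M (M + 1)) xM; apply/nx/xM; rewrite lerDl.
Qed.

(** The mean value theorem bounds the difference quotients of psi uniformly, so
    that dominated convergence applies. *)
Lemma quotient_integral_cvg :
  (\int[lambda]_x (f x * q n x)%:E)%E @[n --> \oo] --> (\int[lambda]_x (f x * D x)%:E)%E.
Proof.
have [C DC] := partial_bounded tpsi.
have C0 : 0 <= C by exact: le_trans (DC i 0).
have qC n x : `|q n x| <= C.
  by apply: (quotient_bounded tpsi) => //; have /andP[] := h01 n.
apply: (@dominated_cvg _ (borel_rV R d) R lambda setT measurableT _ _
  (EFin \o (fun x => B * C * \1_(cube (M + 1)) x))) => //.
- move=> n; apply/measurable_EFinP; apply: continuous_measurable_rV.
  by apply: rV_continuousM; [exact: lipschitz_continuous|exact: qc].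
- move=> x _; apply: cvg_EFin; first exact: nearW.
  apply: cvgM; first exact: cvg_cst.
  apply: ((cvgr_dnbhsP (fun h => h^-1 * (p (x + h *: e i) - p x)) 0 (D x)).1 _ h).
    exact: (quotient_cvg tpsi).
  split; last exact: cvg_harmonic.
  by move=> n; rewrite gt_eqF//; have /andP[] := h01 n.
- apply: (@cube_supported_integrable _ _ _ (M + 1) (B * C)).
  + apply: measurable_funM => //.
    by apply: measurable_indic; exact: measurable_cube.
  + move=> x; rewrite normrM ger0_norm ?mulr_ge0// ler_piMr ?mulr_ge0//.
    by rewrite indicE; case: (_ \in _); rewrite ?normr1 ?normr0.
  + by move=> x nx; rewrite indicE memNset// mulr0.
- move=> n x _ /=; rewrite lee_fin indicE; case: (boolP (x \in _)) => xQ.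
    by rewrite mulr1 normrM ler_pM.
  by rewrite q_out ?mulr0 ?normr0// => /mem_set; apply/negP.
Qed.

(* translated by h n *: e i, this is the first of the two products that make up
   h n * (f * q n) *)
Let F n (x : 'rV[R]_d) : R := f (x - h n *: e i) * p x.

(** Translation invariance moves the difference quotient from the test field to
    f, where the Lipschitz constant bounds it; this is integration by parts
    without a derivative of f. *)
Lemma quotient_integral_le n :
  (\int[lambda]_x (f x * q n x)%:E <= (K * fine (lambda (cube M)))%:E)%E.
Proof.
have mQ := measurable_cube M.
have fc := lipschitz_continuous.
have p1 x : `|p x| <= 1 by exact: coord_le1.
have /andP[h0 h1] := h01 n.
have int_out (g : 'rV[R]_d -> R) N C : continuous g -> (forall x, `|g x| <= C) ->
    (forall x, ~ cube N x -> g x = 0) -> lambda.-integrable setT (EFin \o g).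
  by move=> cg gC g0; apply: cube_supported_integrable gC g0; exact: continuous_measurable_rV.
have cF : continuous (F n).
  apply: rV_continuousM; last exact: pc.
  exact: (@translate_continuous f (- (h n *: e i)) fc).
have bF x : `|F n x| <= B by rewrite normrM -[leRHS]mulr1 ler_pM.
have iF : lambda.-integrable setT (EFin \o F n).
  by apply: (int_out _ M B) => // x nx; rewrite /F out ?mulr0.
have ifp : lambda.-integrable setT (EFin \o (fun x => f x * p x)).
  apply: (int_out _ M B).
  - exact: rV_continuousM fc pc.
  - by move=> x; rewrite normrM -[leRHS]mulr1 ler_pM.
  - by move=> x nx; rewrite out ?mulr0.
have iFs : lambda.-integrable setT (EFin \o (fun x => F n (x + h n *: e i))).
  apply: (int_out _ (M + 1) B).
  - exact: translate_continuous.
  - by move=> x; exact: bF.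
  - by move=> x nx; rewrite /F shift_out ?mulr0.
have E1 : (\int[lambda]_x (f x * q n x))%R =
    (h n)^-1 * (\int[lambda]_x (F n x - f x * p x))%R.
  rewrite RintegralB// -(integral_translation iFs); last exact: continuous_measurable_rV.
  rewrite -RintegralB// -RintegralZl//; last first.
    by apply: (integrableB measurableT iFs ifp).
  by apply: eq_Rintegral => x _; rewrite /F addrK /q; ring.
have [C DC] := partial_bounded tpsi.
have ifq : lambda.-integrable setT (EFin \o (fun x => f x * q n x)).
  apply: (int_out _ (M + 1) (B * C)).
  - by apply: rV_continuousM => //; exact: qc.
  - by move=> x; rewrite normrM ler_pM//; exact: (quotient_bounded tpsi).
  - by move=> x nx; rewrite q_out ?mulr0.
rewrite -[leLHS]fineK; last exact: integrable_fin_num.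
rewrite lee_fin -[fine _]/(\int[lambda]_x (f x * q n x))%R E1 ler_pdivrMl//.
have -> : h n * (K * fine (lambda (cube M))) =
    (\int[lambda]_(x in cube M) (K * h n))%R.
  by rewrite Rintegral_cst//; ring.
rewrite [leRHS]Rintegral_mkcond.
apply: le_Rintegral => //.
- exact: (integrableB measurableT iF ifp).
- apply: (@cube_supported_integrable _ _ _ M (K * h n)).
  + by apply: (measurable_restrictT (fun=> K * h n) mQ).1; exact: measurable_cst.
  + move=> x; rewrite patchE; case: ifPn => _; rewrite ?normr0 ?mulr_ge0 ?(ltW h0)//.
    by rewrite ger0_norm ?mulr_ge0 ?(ltW h0).
  + by move=> x nx; rewrite patchE memNset.
- move=> x _; rewrite patchE; case: ifPn => xQ; last first.
    by rewrite /F out ?mulr0 ?subrr// => /mem_set; apply/negP.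
  rewrite /F -mulrBl (le_trans (ler_norm _))// normrM -[leRHS]mulr1.
  apply: ler_pM => //; apply: le_trans (fK _ _) _.
  rewrite addrAC subrr sub0r normrN normrZ gtr0_norm// ler_wpM2l//.
  by rewrite -[leRHS]mulr1 ler_wpM2l ?(ltW h0)// norm_delta_le.
Qed.

Lemma partial_integral_le :
  (\int[lambda]_x (f x * D x)%:E <= (K * fine (lambda (cube M)))%:E)%E.
Proof.
apply: (cvge_to_le quotient_integral_cvg).
by apply: nearW => n; exact: quotient_integral_le.
Qed.

Lemma partial_integrable : lambda.-integrable setT (EFin \o (fun x => f x * D x)).
Proof.
have [C DC] := partial_bounded tpsi.
apply: (@cube_supported_integrable _ _ _ M (B * C)).
- apply: continuous_measurable_rV; apply: rV_continuousM lipschitz_continuous _.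
  exact: (partial_continuous tpsi).
- by move=> x; rewrite normrM ler_pM.
- by move=> x nx; rewrite (derive_out tpsi) ?mxE ?mulr0// => /OM.
Qed.

End one_field.

Lemma lipschitz_divergence_le psi : test_field Omega psi ->
  (forall x, euclidean_norm (psi x) <= 1) ->
  (\int[lambda]_x (f x * divergence psi x)%:E <=
   (d%:R * (K * fine (lambda (cube M))))%:E)%E.
Proof.
move=> tpsi psi1.
have -> : (\int[lambda]_x (f x * divergence psi x)%:E)%E =
    (\sum_(i < d) \int[lambda]_x (f x * 'D_(e i) psi x 0 i)%:E)%E.
  rewrite -(@integral_sum _ _ _ _ _ measurableT) => [|i].
    by apply: eq_integral => x _; rewrite /divergence mulr_sumr sumEFin.
  exact: partial_integrable.
apply: (@le_trans _ _ (\sum_(i < d) (K * fine (lambda (cube M)))%:E)%E).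
  by apply: lee_sum => i _; exact: partial_integral_le.
by rewrite sumEFin sumr_const card_ord mulr_natl.
Qed.

Lemma lipschitz_total_variation (oO : open Omega) :
  (Defs.total_variation oO f <= (d%:R * (K * fine (lambda (cube M))))%:E)%E.
Proof.
apply: ge_ereal_sup => _ [psi [tpsi psi1] <-].
apply: le_trans (lipschitz_divergence_le tpsi psi1).
have mO : measurable (Omega : set (borel_rV R d)) := open_rV_measurable oO.
have out x : ~ Omega x -> (f x * divergence psi x)%:E = 0%E.
  move=> nx; rewrite /divergence big1 ?mulr0// => i _.
  by rewrite (derive_out tpsi) ?mxE.
have F0 : (fun x => (f x * divergence psi x)%:E) \_ Omega = (fun x => (f x * divergence psi x)%:E).
  by apply/funext => x; rewrite patchE; case: ifPn => // /negP xO; rewrite out// => /mem_set.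
rewrite -[in leLHS]F0 -[in leRHS]F0 -!integral_mkcond.
rewrite le_eqVlt; apply/orP; left; apply/eqP.
apply: eq_measure_integral => A mA AO; rewrite /= /mrestr.
by rewrite (setIidl AO).
Qed.

End lipschitz_total_variation.

(** * Approximation by orthogonality *)

Lemma closure_normP (R : realType) (H : normedModType R) (E : set H) x :
  closure E x <-> forall e, 0 < e -> exists f, E f /\ `|x - f| < e.
Proof.
split=> [cE e e0|h U /nbhs_ballP[e /= e0 eU]].
  have [f [Ef]] := cE _ (nbhsx_ballx x e e0).
  by rewrite -ball_normE => xf; exists f.
by have [f [Ef xf]] := h e e0; exists f; split => //; apply: eU; rewrite -ball_normE.
Qed.

Section orthogonal_density.
Context (R : realType) (H : completeNormedModType R) (ip : H -> H -> R).
Hypothesis hip : inner_product ip.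

(** The projection of x onto the closure of the subspace E leaves a remainder
    orthogonal to E. *)
Lemma dense_of_orthogonal (E : set H) : E 0 ->
  (forall a x y, E x -> E y -> E (x + a *: y)) ->
  (forall z, (forall f, E f -> ip z f = 0) -> z = 0) ->
  forall x e, 0 < e -> exists f, E f /\ `|x - f| < e.
Proof.
move=> E0 EZ Eorth x; apply/closure_normP.
have cvV : convex_subset (closure E).
  move=> p q s /andP[s0 s1] /closure_normP hp /closure_normP hq.
  apply/closure_normP => e e0; have e20 : 0 < e / 2 by lra.
  have [f [Ef pf]] := hp _ e20; have [g [Eg qg]] := hq _ e20.
  exists (f + s *: (g - f)); split.
    by apply: (EZ) => //; rewrite -scaleN1r; exact: EZ.
  have -> : p + s *: (q - p) - (f + s *: (g - f)) = (1 - s) *: (p - f) + s *: (q - g).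
    by apply: (eq_ip hip) => z; rewrite !(ipE hip); ring.
  rewrite (le_lt_trans (ler_normD _ _))// !normrZ !ger0_norm ?subr_ge0//.
  rewrite [e]splitr; apply: (@le_lt_trans _ _ (`|p - f| + `|q - g|)); last exact: ltrD.
  by rewrite lerD// ler_piMl//; lra.
have [p [Vp pP]] := projection_exists hip (ex_intro _ 0 (subset_closure E0))
  (@closed_closure _ E) cvV x.
have pE f t : E f -> closure E (p + t *: f).
  move=> Ef; apply/closure_normP => e e0.
  have /closure_normP/(_ e e0)[g [Eg pg]] := Vp.
  by exists (g + t *: f); split; [exact: EZ|rewrite opprD addrACA subrr addr0].
have : x - p = 0.
  apply: Eorth => f Ef; apply/eqP; rewrite eq_le.
  have E1 t : p + t *: f - p = t *: f by rewrite addrAC subrr add0r.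
  have := pP _ (pE f 1 Ef); have := pP _ (pE f (-1) Ef).
  by rewrite !E1 !(ipZr hip); lra.
by move/subr0_eq => ->.
Qed.

End orthogonal_density.

Section distance_functions.
Context (R : realType) (d : nat).
Implicit Types (U : set 'rV[R]_d) (x y : 'rV[R]_d).

(** The truncated distance min (1, n * dist (x, complement of U)); throwing 1
    into the set makes it 1 when U is the whole space. As n grows it tends to
    the indicator function of an open set U. *)
Definition plateau U (n : nat) x : R :=
  inf ([set Num.min 1 (n%:R * `|x - y|) | y in ~` U] `|` [set 1]).

Let has_inf_plateau U n x :
  has_inf ([set Num.min 1 (n%:R * `|x - y|) | y in ~` U] `|` [set 1]).
Proof.
split; first by exists 1; right.
by exists 0 => _ [[y _ <-]|->//]; rewrite le_min ler01 mulr_ge0.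
Qed.

Lemma plateau_ge0 U n x : 0 <= plateau U n x.
Proof.
apply: lb_le_inf; first exact: (has_inf_plateau U n x).1.
by move=> _ [[y _ <-]|->//]; rewrite le_min ler01 mulr_ge0.
Qed.

Lemma plateau_le1 U n x : plateau U n x <= 1.
Proof. by apply: ge_inf; [exact: (has_inf_plateau U n x).2|right]. Qed.

Lemma plateau_out U n x : ~ U x -> plateau U n x = 0.
Proof.
move=> nU; apply/eqP; rewrite eq_le plateau_ge0 andbT.
apply: ge_inf; first exact: (has_inf_plateau U n x).2.
left; exists x => //; rewrite subrr normr0 mulr0.
by apply/min_idPr; exact: ler01.
Qed.

Lemma plateau_lipschitz U n x x' :
  `|plateau U n x - plateau U n x'| <= n%:R * `|x - x'|.
Proof.
suff h y y' : plateau U n y <= plateau U n y' + n%:R * `|y - y'|.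
  by rewrite ler_norml; have := h x x'; have := h x' x; rewrite (distrC x'); lra.
rewrite -lerBlDr; apply: lb_le_inf; first exact: (has_inf_plateau U n y').1.
move=> _ [[z Uz <-]|->]; last first.
  by rewrite lerBlDr (le_trans (plateau_le1 _ _ _))// lerDl mulr_ge0.
rewrite lerBlDr; apply: (@le_trans _ _ (Num.min 1 (n%:R * `|y - z|))).
  by apply: ge_inf; [exact: (has_inf_plateau U n y).2|left; exists z].
have tr : n%:R * `|y - z| <= n%:R * `|y' - z| + n%:R * `|y - y'|.
  rewrite -mulrDr ler_wpM2l// [leRHS]addrC.
  by have := ler_normD (y - y') (y' - z); rewrite addrA subrK.
have n0 : 0 <= n%:R * `|y - y'| by rewrite mulr_ge0.
by case: (leP 1 (n%:R * `|y - z|)); case: (leP 1 (n%:R * `|y' - z|)); lra.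
Qed.

Lemma plateau_in U x : open U -> U x ->
  plateau U n x @[n --> \oo] --> (1 : R).
Proof.
move=> oU Ux; have /nbhs_ballP[r /= r0 rU] := open_nbhs_nbhs (conj oU Ux).
apply/cvgrPdist_le => e e0; exists (Num.truncn r^-1).+1 => // n /= rn.
suff -> : plateau U n x = 1 by rewrite subrr normr0 ltW.
apply/eqP; rewrite eq_le plateau_le1 /=.
apply: lb_le_inf; first exact: (has_inf_plateau U n x).1.
move=> _ [[y Uy <-]|->//]; rewrite le_min lexx /=.
have ry : r <= `|x - y|.
  rewrite leNgt; apply/negP => xy; apply: Uy; apply: rU.
  by rewrite mx_norm_ball.
have nr : r^-1 <= n%:R.
  by apply: le_trans (ltW (truncnS_gt _)) _; rewrite ler_nat.
have r1 : r != 0 by rewrite gt_eqF.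
by apply: (@le_trans _ _ (r^-1 * r)); [rewrite mulVf|apply: ler_pM; rewrite ?invr_ge0// ltW].
Qed.

End distance_functions.

(** * Density of the Lipschitz functions in L^2 *)

Section lipschitz_density.
Context (R : realType) (d : nat) (mu : {measure set (borel_rV R d) -> \bar R}).
Hypothesis mufin : (mu setT < +oo)%E.
Notation Lfun2 := (LfunType mu (lee1n 2)).

Definition bounded_lipschitz (f : 'rV[R]_d -> R) :=
  exists B K : R, (forall x, `|f x| <= B) /\ forall x y, `|f x - f y| <= K * `|x - y|.

Lemma bounded_Lfun2 (f : 'rV[R]_d -> R) (B : R) :
  measurable_fun setT (f : borel_rV R d -> R) -> (forall x, `|f x| <= B) ->
  (f : borel_rV R d -> R) \in Lfun mu 2%:E.
Proof.
move=> mf fB; apply: Lfun2P => //.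
apply: (@le_lt_trans _ _ (\int[mu]_x (cst (B ^+ 2)%:E x))%E).
  apply: ge0_le_integral => //.
  - by move=> x _; rewrite lee_fin sqr_ge0.
  - by apply/measurable_EFinP; exact: measurable_funX.
  - move=> x _ /=; rewrite lee_fin -real_normK ?num_real//.
    by rewrite ler_pXn2r ?nnegrE// (le_trans _ (fB x)).
by rewrite integral_cst// lte_mul_pinfty// lee_fin sqr_ge0.
Qed.

Definition lipschitz_classes : set (L2 mu) :=
  [set u | exists F : Lfun2, bounded_lipschitz F /\ u = L2class F].

Lemma bounded_lipschitz_class (f : 'rV[R]_d -> R) : bounded_lipschitz f ->
  exists F : Lfun2, (F = f :> (_ -> _)) /\ lipschitz_classes (L2class F).
Proof.
move=> fL; have [B [K [fB fK]]] := fL.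
have mf : measurable_fun setT (f : borel_rV R d -> R).
  by apply: continuous_measurable_rV; exact: lipschitz_continuous fK.
exists (Lfun_Sub (lee1n 2) (bounded_Lfun2 mf fB)); split => //.
by eexists; split; last reflexivity.
Qed.

Lemma measure_fin_num : mu setT \is a fin_num.
Proof. by rewrite ge0_fin_numE. Qed.

Lemma L2fun_integrable (u : L2 mu) : mu.-integrable setT (EFin \o L2fun u).
Proof.
apply/Lfun1_integrable; apply: (Lfun_subset12 measure_fin_num).
exact: LfunP.
Qed.

Lemma L2class0 : L2class (0 : Lfun2) = 0.
Proof. by rewrite /L2class piE. Qed.

(** Such a z has integral zero on every open set, whose indicator function is a
    limit of Lipschitz functions, hence on every Borel set by Dynkin's lemma. *)
Lemma lipschitz_orthogonal (z : L2 mu) :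
  (forall u, lipschitz_classes u -> L2_inner z u = 0) -> z = 0.
Proof.
move=> orth; pose f := L2fun z.
have iz := L2fun_integrable z.
have mf : measurable_fun setT f by exact: Lfun2_measurable.
have openP (U : set 'rV[R]_d) : open U -> (\int[mu]_(x in U) (f x)%:E = 0)%E.
  move=> oU; have mU : measurable (U : set (borel_rV R d)) := open_rV_measurable oU.
  have bl n : bounded_lipschitz (plateau U n).
    exists 1, n%:R; split; last exact: plateau_lipschitz.
    by move=> x; rewrite ger0_norm ?plateau_ge0 ?plateau_le1.
  have z0 n : (\int[mu]_x (f x * plateau U n x)%:E = 0)%E.
    have [F [FE LF]] := bounded_lipschitz_class (bl n).
    have := orth _ LF; rewrite -{1}(L2funK z) L2_innerE => zF.
    have iF := Lfun2_integrable_mul f F.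
    rewrite -[X in (_ = X%:E)%E]zF /Rintegral fineK; last exact: integrable_fin_num iF.
    by apply: eq_integral => x _; rewrite FE.
  rewrite integral_mkcond.
  have c : (\int[mu]_x (f x * plateau U n x)%:E)%E @[n --> \oo] -->
      (\int[mu]_x ((fun x => (f x)%:E) \_ U) x)%E.
    apply: (@dominated_cvg _ _ _ mu setT measurableT _ _ (fun x => (`|f x|)%:E)) => //.
    - move=> n; apply/measurable_EFinP; apply: measurable_funM => //.
      apply: continuous_measurable_rV.
      by have [B [K [_ fK]]] := bl n; exact: lipschitz_continuous fK.
    - move=> x _; rewrite patchE; case: ifPn => xU.
        apply: cvg_EFin; first exact: nearW.
        rewrite -[X in _ --> X]mulr1; apply: cvgM; first exact: cvg_cst.
        by apply: plateau_in => //; exact: set_mem.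
      rewrite (_ : (fun _ => _) = cst 0%E); first exact: cvg_cst.
      by apply/funext => n; rewrite plateau_out ?mulr0// => /mem_set; apply/negP.
    - exact: integrable_abse iz.
    - move=> n x _ /=; rewrite lee_fin normrM ler_piMr//.
      by rewrite ger0_norm ?plateau_ge0 ?plateau_le1.
  have c0 : (\int[mu]_x (f x * plateau U n x)%:E)%E @[n --> \oo] --> 0%E.
    by under eq_fun do rewrite z0; exact: cvg_cst.
  exact: (cvg_unique _ c c0).
have borelP (A : set (borel_rV R d)) : measurable A -> (\int[mu]_(x in A) (f x)%:E = 0)%E.
  move=> mA; apply: (@dynkin_induction _ (borel_rV R d) (@open 'rV[R]_d)
    (fun A => (\int[mu]_(x in A) (f x)%:E = 0)%E)) => //.
  - by move=> U V oU oV; exact: openI.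
  - by apply: openP; exact: openT.
  - move=> S mS S0; have : (\int[mu]_(x in S `|` ~` S) (f x)%:E = 0)%E.
      by rewrite setUv; apply: openP; exact: openT.
    rewrite integral_setU ?S0 ?add0e//; first exact: measurableC.
    + by rewrite setUv; exact/measurable_EFinP.
    + by apply/disj_setPS; rewrite setICr.
  - move=> F mF tF F0; rewrite integral_bigcup//.
      by rewrite eseries0.
    by apply: integrableS iz => //; exact: bigcupT_measurable.
have zE : z = L2class (0 : Lfun2).
  rewrite -(L2funK z); apply/L2_eqP.
  have := @integral_ae_eq _ _ _ mu setT measurableT (cst 0%E) (EFin \o f) iz.
  move=> /(_ (measurable_cst _)) h.
  have {}h : ae_eq mu setT (EFin \o f) (cst 0%E).
    by apply: h => E _ mE; rewrite borelP// integral0.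
  by apply: filterS h => x /(_ I) [].
by rewrite zE L2class0.
Qed.

Lemma lipschitz_dense (x : L2 mu) (e : R) : 0 < e ->
  exists f, lipschitz_classes f /\ `|x - f| < e.
Proof.
move: e; apply: (dense_of_orthogonal (L2_inner_product mu)).
- exists 0; split; last by rewrite L2class0.
  exists 0, 0; split => [y|y y']; rewrite -[(0 : Lfun2) y]/(0 : R) ?normr0//.
  by rewrite subrr normr0 mul0r.
- move=> a u v [F [[B [K [FB FK]]] ->]] [G [[B' [K' [GB GK]]] ->]].
  rewrite L2class_scale -L2classD.
  exists (F + a *: G); split => //; exists (B + `|a| * B'), (K + `|a| * K'); split.
  + move=> y; rewrite -[(F + _) y]/(F y + a * G y) (le_trans (ler_normD _ _))// lerD// normrM.
    by rewrite ler_wpM2l.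
  + move=> y y'; rewrite -[(F + _) y]/(F y + a * G y) -[(F + _) y']/(F y' + a * G y').
    rewrite opprD addrACA -mulrBr (le_trans (ler_normD _ _))// mulrDl lerD// normrM.
    by rewrite -mulrA ler_wpM2l.
- exact: lipschitz_orthogonal.
Qed.

End lipschitz_density.

(** * The subdifferential of the total variation *)

Section subdifferential.
Context (R : realType) (d : nat) (Omega : set 'rV[R]_d) (oO : open Omega).
Hypothesis bO : bounded_set Omega.
Notation mu := (lebesgue_on oO).
Notation L2O := (L2 mu).
Notation ip := (@L2_inner _ _ _ mu).
Notation TV u := (Defs.total_variation oO (L2fun u)).
Implicit Types (u v w eta g : L2O).

Lemma lebesgue_on_finite : (mu setT < +oo)%E.
Proof.
have [M M0 OM] := bounded_sub_cube bO.
apply: le_lt_trans (open_box_cube_lty d M).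
rewrite /= /mrestr setTI; apply: le_measure => //; rewrite inE.
- exact: open_rV_measurable.
- by apply: open_rV_measurable; exact: open_box_open.
Qed.

Lemma divergence_measurable psi : test_field Omega psi ->
  measurable_fun setT (divergence psi : borel_rV R d -> R).
Proof.
move=> tpsi; apply: continuous_measurable_rV.
suff h (s : seq 'I_d) : continuous (fun x : 'rV[R]_d =>
    \sum_(i <- s) ('D_(delta_mx 0 i) psi x) 0 i) by exact: h.
elim: s => [|i s IH].
  under eq_fun do rewrite big_nil; exact: cst_continuous.
under eq_fun do rewrite big_cons.
by move=> x; exact: (cvgD (@partial_continuous _ _ _ _ tpsi i x) (IH x)).
Qed.

(** On a bounded domain a divergence is square-integrable, so that phi is a
    supremum of continuous linear forms of L^2. *)
Lemma divergence_class psi : test_field Omega psi ->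
  exists g, forall u,
    (\int[mu]_x (L2fun u x * divergence psi x)%:E = (ip g u)%:E)%E.
Proof.
move=> tpsi; have [C DC] := partial_bounded tpsi.
have md := divergence_measurable tpsi.
have dB x : `|divergence psi x| <= \sum_(i < d) C.
  by rewrite (le_trans (ler_norm_sum _ _ _))// ler_sum.
pose F := Lfun_Sub (lee1n 2) (bounded_Lfun2 lebesgue_on_finite md dB).
exists (L2class F) => u.
rewrite -{2}(L2funK u) L2_innerE /Rintegral fineK; last first.
  exact: integrable_fin_num (Lfun2_integrable_mul F (L2fun u)).
by apply: eq_integral => x _; rewrite mulrC.
Qed.

Lemma total_variation_le u (c : \bar R) :
  (TV u <= c)%E <-> forall psi, test_field Omega psi ->
    (forall x, euclidean_norm (psi x) <= 1) ->
    (\int[mu]_x (L2fun u x * divergence psi x)%:E <= c)%E.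
Proof.
split=> [TVc psi tpsi psi1|h].
  by apply: le_trans TVc; apply: ereal_sup_ubound; exists psi.
by apply: ge_ereal_sup => _ [psi [tpsi psi1] <-]; exact: h.
Qed.

Lemma total_variation_ge0 u : (0 <= TV u)%E.
Proof.
apply: ereal_sup_ubound; exists (cst 0); last first.
  rewrite (_ : (fun x => _) = cst 0%E); first exact: integral0.
  apply/funext => x; rewrite /divergence big1 ?mulr0// => i _.
  by rewrite derive_cst mxE.
split; last first.
  by move=> x; rewrite /euclidean_norm big1 ?sqrtr0// => i _; rewrite mxE expr0n.
have supp0 : [set x : 'rV[R]_d | (cst 0 : 'rV[R]_d -> 'rV[R]_d) x != 0] = set0.
  by apply/seteqP; split => x //=; rewrite eqxx.
split; rewrite ?supp0 ?closure0//; last exact: compact0.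
elim=> [|k IH]; first by split => //; exact: cst_continuous.
split; first exact: cst_continuous.
move=> v; split; first by move=> x; exact: derivable_cst.
rewrite (_ : (fun x => _) = cst 0)//.
by apply/funext => x; rewrite derive_cst.
Qed.

Lemma total_variationZ (c : R) u : 0 < c -> (TV (c *: u) <= c%:E * TV u)%E.
Proof.
move=> c0; apply/total_variation_le => psi tpsi psi1.
have [g gP] := divergence_class tpsi.
rewrite gP (ipZr (L2_inner_product mu)) EFinM -gP lee_pmul2l//.
by move: psi tpsi psi1 {g gP}; exact/total_variation_le.
Qed.

Lemma BVE u : BV oO (L2fun u) <-> (TV u < +oo)%E.
Proof.
split=> [[]//|TVu]; split => //.
apply: (Lfun_subset12 (measure_fin_num lebesgue_on_finite)); exact: LfunP.
Qed.

Lemma phiE u : phi oO u = TV u.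
Proof.
rewrite /phi; case: asboolP => // /BVE /negP; rewrite -leNgt leye_eq => /eqP.
by [].
Qed.

(** phi is the support function of this closed convex set: it contains the
    divergences of the test fields bounded by 1, by which phi is defined. *)
Definition dual_ball : set L2O :=
  [set g | forall v, ((ip g v)%:E <= TV v)%E].

Lemma dual_ball0 : dual_ball 0.
Proof. by move=> v; rewrite (ip0l (L2_inner_product mu)) total_variation_ge0. Qed.

Lemma dual_ball_closed : closed dual_ball.
Proof.
move=> p /closure_normP cp v; apply/lee_addgt0Pr => e e0.
have v0 : 0 < `|v| + 1 by rewrite ltr_wpDl.
have [g [Cg pg]] := cp _ (divr_gt0 e0 v0).
rewrite -(subrK g p) (ipDl (L2_inner_product mu)) addrC EFinD leeD//.
rewrite lee_fin; apply: le_trans (cauchy_schwarz (L2_inner_product mu) _ _) _.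
move: pg; rewrite ltr_pdivlMr// => /ltW; apply: le_trans.
by rewrite ler_wpM2l// lerDl.
Qed.

Lemma dual_ball_convex : convex_subset dual_ball.
Proof.
move=> p q s /andP[s0 s1] hp hq v.
rewrite (ipDl (L2_inner_product mu)) (ipZl (L2_inner_product mu)) (ipBl (L2_inner_product mu)).
have [TVy|] := eqVneq (TV v) +oo%E; first by rewrite TVy leey.
rewrite -ltey => TVfin.
have fT : TV v \is a fin_num by rewrite ge0_fin_numE// total_variation_ge0.
have := hp v; have := hq v; rewrite -(fineK fT) !lee_fin => h1 h2.
have := ler_wpM2l s0 h1.
have : (1 - s) * ip p v <= (1 - s) * fine (TV v) by rewrite ler_wpM2l// subr_ge0.
lra.
Qed.

Lemma divergence_dual_ball psi g : test_field Omega psi ->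
  (forall x, euclidean_norm (psi x) <= 1) ->
  (forall u, (\int[mu]_x (L2fun u x * divergence psi x)%:E = (ip g u)%:E)%E) ->
  dual_ball g.
Proof.
move=> tpsi psi1 gP v; rewrite -gP.
by apply: ereal_sup_ubound; exists psi.
Qed.

(** Because phi is the support function of dual_ball, a subgradient at u is
    an element of dual_ball that is maximal in the direction u. *)
Lemma subdiff_phiE u : subdiff_phi oO u = maximizers ip dual_ball u.
Proof.
have hip := L2_inner_product mu.
apply/seteqP; split => eta.
  move=> [/BVE TVu sub].
  have fTu : TV u \is a fin_num by rewrite ge0_fin_numE// total_variation_ge0.
  have TV0 : TV (0 : L2O) = 0%E.
    apply/eqP; rewrite eq_le total_variation_ge0 andbT.
    apply/total_variation_le => psi tpsi psi1.
    by have [g ->] := divergence_class tpsi; rewrite (ip0r hip).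
  (* the subgradient inequality against v = 0 *)
  have etau : (TV u <= (ip eta u)%:E)%E.
    have := sub 0; rewrite !phiE TV0 subr0 add0e; apply.
    by apply/BVE; rewrite TV0 ltry.
  (* the subgradient inequality against the multiples s *: w, for large s *)
  have Ceta : dual_ball eta.
    move=> w; have [->|] := eqVneq (TV w) +oo%E; first by rewrite leey.
    rewrite -ltey => TVw.
    have fTw : TV w \is a fin_num by rewrite ge0_fin_numE// total_variation_ge0.
    rewrite -(fineK fTw) lee_fin.
    have key (s : R) : 0 < s -> fine (TV u) <= s * fine (TV w) + (ip eta u - s * ip eta w).
      move=> s0; rewrite -lee_fin (EFinD (s * _)) (EFinM s) !fineK//.
      have := sub (s *: w); rewrite !phiE (ipBr hip) (ipZr hip) => h.
      apply: le_trans (h _) _; last by rewrite leeD2r// total_variationZ.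
      apply/BVE; apply: le_lt_trans (total_variationZ _ s0) _.
      by rewrite -(fineK fTw) -EFinM ltry.
    rewrite leNgt; apply/negP => lt.
    pose k := ip eta w - fine (TV w); have k0 : 0 < k by rewrite subr_gt0.
    pose s := (`|ip eta u - fine (TV u)| + 1) / k.
    have s0 : 0 < s by rewrite divr_gt0// ltr_wpDl.
    have sk : s * k = `|ip eta u - fine (TV u)| + 1 by rewrite /s divfK// gt_eqF.
    have := key s s0; have := ler_norm (ip eta u - fine (TV u)).
    by move: sk; rewrite /k mulrBr; lra.
  split => // g Cg; rewrite -lee_fin; exact: le_trans (Cg u) etau.
move=> [Ceta mx].
have etau : (TV u <= (ip eta u)%:E)%E.
  apply/total_variation_le => psi tpsi psi1.
  have [g gP] := divergence_class tpsi.
  by rewrite gP lee_fin; apply: mx; exact: divergence_dual_ball gP.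
split; first by apply/BVE; exact: le_lt_trans etau (ltry _).
move=> v _; rewrite !phiE (ipBr hip).
apply: (le_trans etau).
apply: (@le_trans _ _ ((ip eta v)%:E + (ip eta u - ip eta v)%:E)%E).
  by rewrite -EFinD addrC subrK.
by rewrite leeD2r.
Qed.

(** Lipschitz functions have finite total variation and are dense. *)
Lemma finite_variation_dense u (e : R) : 0 < e ->
  exists v m, (forall g, dual_ball g -> ip g v <= m) /\ `|u - v| < e.
Proof.
move=> e0.
have [v [[F [[B [K [FB FK]]] ->]] uv]] := lipschitz_dense lebesgue_on_finite u e0.
have [M M0 OM] := bounded_sub_cube bO.
exists (L2class F); eexists; split; last exact: uv.
move=> g Cg; rewrite -lee_fin; apply: le_trans (Cg _) _.
apply: le_trans (lipschitz_total_variation FB FK OM oO).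
apply/total_variation_le => psi tpsi psi1.
apply: ereal_sup_ubound; exists psi => //.
have md := divergence_measurable tpsi.
apply: ae_eq_integral => //.
- apply/measurable_EFinP; apply: measurable_funM md.
  exact: (Lfun2_measurable F).
- apply/measurable_EFinP; apply: measurable_funM md.
  exact: (Lfun2_measurable (L2fun (L2class F))).
- by apply: filterS (L2classK F) => x /= -> _.
Qed.

End subdifferential.

Theorem theorem4p1 (R : realType) (d : nat) (d_gt0 : (0 < d)%N)
    (Omega : set 'rV[R]_d) (oO : open Omega) (cO : connected Omega)
    (nO : Omega !=set0) (bO : bounded_set Omega)
    (pO : piecewise_smooth_boundary Omega) (T : R) (T_gt0 : 0 < T) :
  closure (dom_subdiff_phi oO) = setT /\
  forall u0 : L2 (lebesgue_on oO),
    exists u : R -> L2 (lebesgue_on oO),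
      [/\ TV_flow T u0 u,
          forall v : R -> L2 (lebesgue_on oO),
            TV_flow T u0 v -> {in `[0, T], v =1 u} &
          dom_subdiff_phi oO u0 -> W1infty 0 T u].
Proof.
have hip := L2_inner_product (lebesgue_on oO).
pose A := maximizers (@L2_inner _ _ _ (lebesgue_on oO)) (@dual_ball _ _ _ oO).
have AE u : subdiff_phi oO u = A u by exact: subdiff_phiE.
have C0 := @dual_ball0 _ _ _ oO.
have mA : monotone_graph (@L2_inner _ _ _ (lebesgue_on oO)) A by exact: maximizers_monotone.
have rA : full_range A.
  by apply: maximizers_full_range => //; [exact: dual_ball_closed|exact: dual_ball_convex].
have dA : forall x e, 0 < e -> exists y eta, A y eta /\ `|x - y| < e.
  apply: (maximizers_dense hip C0 (@dual_ball_closed _ _ _ oO) (@dual_ball_convex _ _ _ oO)).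
  exact: finite_variation_dense.
split.
  apply/seteqP; split => // x _; apply/closure_normP => e e0.
  have [y [eta [Ay xy]]] := dA x e e0.
  by exists y; split => //; exists eta; rewrite AE.
move=> u0; exists (flow A ^~ u0).
have flowP : TV_flow T u0 (flow A ^~ u0).
  split.
  - apply: continuous_subspaceT; exact: (flow_continuous hip mA rA dA).
  - move=> r /andP[r0 rT].
    have [eta [Aeta _]] := flow_smoothing hip mA rA dA (maximizers_homogeneous hip (C := @dual_ball _ _ _ oO)) (maximizers0 hip C0) u0 r0.
    exact: (flow_W1infty hip mA rA dA T (ltW r0) Aeta).
  - move=> t /andP[t0 tT].
    have [eta [Aeta _]] := flow_smoothing hip mA rA dA (maximizers_homogeneous hip (C := @dual_ball _ _ _ oO)) (maximizers0 hip C0) u0 t0.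
    exists (- min_section A (flow A t u0)), (min_section A (flow A t u0)); split.
    + exact: (flow_right_derivative hip mA rA dA (ltW t0) Aeta).
    + by rewrite AE; have := min_sectionP hip mA rA Aeta.
    + by rewrite addNr.
  - exact: flow_le0.
have solves v : TV_flow T u0 v -> solves_inclusion A T v.
  move=> [cv _ dv _]; split => // t tT.
  have [du [eta [rd [Aeta _] E]]] := dv t tT.
  by exists du, eta; split => //; rewrite -AE.
split => //.
  move=> v vP t; rewrite in_itv/= => tT.
  apply: (solution_unique hip mA T_gt0 (solves _ vP) (solves _ flowP)) => //.
  by have [_ _ _ ->] := vP; have [_ _ _ ->] := flowP.
move=> [eta]; rewrite AE => Aeta.
apply: (flow_W1infty hip mA rA dA T (lexx 0) (xi := eta)).
by rewrite flow_le0.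
Qed.
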